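(* Let $p$ be a prime and $c$ a positive integer. Then: (i) there are only finitely many positive integers $r$ such that $\mathrm{Sp}_4(p^r)$ is a $(3,3,c)$-group; (ii) there are only finitely many positive integers $r$ such that $\mathrm{PSp}_4(p^r)$ is a $(3,3,c)$-group.
   Context: A finite group is a $(3,3,c)$-group if it is generated by two elements $x,y$ with $x^3=y^3=(xy)^c=1$. $\mathrm{Sp}_4(q)$ is the symplectic group of $4\times4$ matrices over the field $\mathbb{F}_q$ and $\mathrm{PSp}_4(q)$ its quotient by the centre. *)

(* Defs.v *)
From HB Require Import structures.
From mathcomp Require Import all_boot all_order all_algebra all_fingroup all_solvable all_field.
Set Implicit Arguments. Unset Strict Implicit. Unset Printing Implicit Defensive.
Import GRing.Theory.

(* Standard alternating form on F^4: J = antidiag(1,1,-1,-1). *)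
Definition symJ (F : fieldType) : 'M[F]_4 :=
  \matrix_(i < 4, j < 4)
    (if (i + j == 3)%N then (if (i < 2)%N then 1 else -1) else 0)%R.

Definition Sp4_set (F : finFieldType) : {set {'GL_4[F]}} :=
  [set g : {'GL_4[F]} | ((GLval g)^T *m symJ F *m GLval g == symJ F)%R].

Lemma Sp4_group_set (F : finFieldType) : group_set (Sp4_set F).
Proof.
apply/group_setP; split.
  by rewrite inE GL_1E trmx1 mul1mx mulmx1.
move=> x y; rewrite !inE => /eqP Hx /eqP Hy.
rewrite GL_MxE trmx_mul !mulmxA -(mulmxA _ _ (GLval x)) -(mulmxA _ (GLval x)^T).
by rewrite -!mulmxA (mulmxA (GLval x)^T) (mulmxA _ (GLval x)) Hx mulmxA Hy.
Qed.

Canonical Sp4 (F : finFieldType) : {group {'GL_4[F]}} := Group (Sp4_group_set F).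

Definition PSp4 (F : finFieldType) := (Sp4 F / 'Z(Sp4 F))%G.

Definition is_33c_group (gT : finGroupType) (G : {group gT}) (c : nat) : Prop :=
  exists x y : gT, [/\ <<[set x; y]>>%g = G :> {set gT},
     (x ^+ 3 = 1)%g, (y ^+ 3 = 1)%g & ((x * y) ^+ c = 1)%g].

(* Main.v *)
Require Import Defs.
From HB Require Import structures.
From mathcomp Require Import all_boot all_order all_algebra all_fingroup all_solvable all_field.
From mathcomp Require Import zify ring.

(* Up to signs the problem is about [x], [y] in [Sp4 F] with [x^3 = y^3 = 1] and [(xy)^m = 1] that
   generate [Sp4 F].  Any finite set [L] of [n x 4] matrices that is stable under negation and under
   right multiplication by [x] and [y] is acted on by [Sp4 F], faithfully because [Sp4 F] is
   irreducible, so it suffices to find such an [L] of size bounded in terms of [p] and [m] only.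

   The coefficients of the characteristic polynomial of [xy] are sums of products of [m]-th roots of
   unity, so they lie in a subfield [K] of bounded order; [L] is found by rigidity of the triple
   [(x, y, xy)], which puts [x] and [y] in a form depending only on elements of [K].  Let
   [n(x) = 1 + x + x^2]; then [n(x) J] is alternating, so either [n(x) = 0], or [x = 1], or the
   characteristic is not 3 and [n(x)] has rank 2.
   - If [n(x) = n(y) = 0], then [x + y + xy + yx = xy + (xy)^-1 - 1] is central, hence a scalar
     of [K], and the [K]-span of [1, x, y, xy] is a ring.
   - If [n(x) = 0] and [n(y)] has rank 2, with row space [U], then [F^4] is the sum of [U] and
     [U x]; in this decomposition [yx] becomes the block companion matrix [[0, 1], [-Y, B]], whose
     characteristic polynomial determines the pair [(Y, B)] of 2 x 2 matrices up to conjugacy.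
   - If both have rank 2, write [x = 1 + C1 (X - 1) R1] and [y = 1 + C2 (Y - 1) R2] with
     [R1 C1 = R2 C2 = 1].  The symplectic form makes [M = R1 C2] and [N = R2 C1] adjoint to each
     other, so [M N = N M = d] is scalar, and [det (x - y^-1) = 9 (1 - d)^2] shows that [d] is at
     most quadratic over the field of the coefficients; the trace of [xy] then gives
     [tr (X M Y N)], and everything is determined by [X] and [T = M Y N]. *)

Set Implicit Arguments. Unset Strict Implicit. Unset Printing Implicit Defensive.
Import GRing.Theory.
Local Open Scope ring_scope.

(** * Characteristic polynomials under Frobenius *)

(** In characteristic [p], [(X - M)^p = X^p - M^p], so the [p]-th power of the characteristic
    polynomial of [M] is that of [M^p] evaluated at [X^p]. It is also the polynomial with
    coefficients raised to the [p]-th power, evaluated at [X^p]. *)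
Lemma char_poly_pFrobenius (F : fieldType) (p n : nat) (M : 'M[F]_n.+1) (i : nat) :
  p \in [pchar F] -> (char_poly (M ^+ p))`_i = (char_poly M)`_i ^+ p.
Proof.
move=> pF; have p_gt0 : (0 < p)%N := prime_gt0 (pcharf_prime pF).
have pP : p \in [pchar {poly F}] by rewrite pchar_poly.
have pM : p \in [pchar 'M[{poly F}]_n.+1] := rmorph_pchar (@scalar_mx _ n.+1) pP.
have fX (f : {poly F}) : f ^+ p = map_poly (pFrobenius_aut pF) f \Po 'X^p.
  rewrite -[f in LHS]coefK poly_def -(pFrobenius_autE pP) rmorph_sum /=.
  rewrite -[f in RHS]coefK poly_def rmorph_sum /= linear_sum /=.
  apply: eq_bigr => j _.
  rewrite -!mul_polyC rmorphM /= !pFrobenius_autE -polyC_exp !rmorphM /= -exprM.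
  by rewrite map_polyC map_polyXn /= comp_polyC comp_Xn_poly -exprM mulnC.
have comX : GRing.comm ('X%:M : 'M[{poly F}]_n.+1) (map_mx polyC M).
  by rewrite /GRing.comm; apply/esym/scalar_mxC.
have detX : char_poly M ^+ p = char_poly (M ^+ p) \Po 'X^p.
  have -> : char_poly M ^+ p = \det (char_poly_mx M ^+ p).
    rewrite /char_poly; elim: (p) => [|k IHk]; first by rewrite !expr0 det1.
    by rewrite !exprS det_mulmx IHk.
  rewrite -(pFrobenius_autE pM) /char_poly_mx pFrobenius_autB_comm // !pFrobenius_autE.
  rewrite /char_poly -det_map_mx; congr (\det _).
  rewrite /char_poly_mx map_mxB map_scalar_mx /= comp_polyX -rmorphXn /=; congr (_ - _).
  rewrite -map_mx_comp -rmorphXn /=.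
  by apply: eq_map_mx => a; rewrite /= comp_polyC.
move/(congr1 (fun f : {poly F} => f`_(i * p))): detX.
rewrite fX !coef_comp_poly_Xn // dvdn_mull // mulnK //.
by rewrite coef_map /= pFrobenius_autE => <-.
Qed.

Lemma exp_pchar_inj (F : fieldType) (p n : nat) :
  p \in [pchar F] -> injective (fun a : F => a ^+ (p ^ n)).
Proof.
move=> pF a b; elim: n a b => [|n IHn] a b; rewrite ?expn0 ?expr1 // expnS !exprM.
by move/IHn => /= /(fmorph_inj (pFrobenius_aut pF)).
Qed.

Lemma expr_modn (R : pzSemiRingType) (a : R) (m i j : nat) :
  a ^+ m = 1 -> i = j %[mod m] -> a ^+ i = a ^+ j.
Proof. by move=> am ij; rewrite -(expr_mod i am) ij expr_mod. Qed.

(** The matrices [M ^+ (p ^ (a + k))] and [M ^+ (p ^ a)] coincide, hence so do their characteristic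
    polynomials, and the injective [p ^ a]-th power cancels. The offset [a] allows [p] to divide
    [m]. *)
Lemma char_poly_fixed (F : fieldType) (p n a k m : nat) (M : 'M[F]_n.+1) (i : nat) :
  p \in [pchar F] -> (p ^ (a + k) = p ^ a %[mod m])%N -> M ^+ m = 1 ->
  (char_poly M)`_i ^+ (p ^ k) = (char_poly M)`_i.
Proof.
move=> pF pak Mm; apply: (exp_pchar_inj (n := a) pF) => /=.
have cpX j : (char_poly (M ^+ (p ^ j)))`_i = (char_poly M)`_i ^+ (p ^ j).
  elim: j => [|j IHj]; first by rewrite expn0 !expr1.
  by rewrite expnSr !exprM char_poly_pFrobenius // IHj.
by rewrite -exprM -expnD addnC -!cpX (expr_modn Mm pak).
Qed.

(** With [a = logn p m], the factor [p ^ a] absorbs the [p]-part of [m]; Euler's theorem handles the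
    part prime to [p]. *)
Lemma expn_eventually_periodic (p m : nat) :
  prime p -> (0 < m)%N -> exists2 k, (0 < k)%N & exists a, (p ^ (a + k) = p ^ a %[mod m])%N.
Proof.
move=> p_pr m_gt0; exists (totient m`_p^').
  by rewrite totient_gt0 part_gt0.
exists (logn p m).
have Em : m = (p ^ logn p m * m`_p^')%N by rewrite -p_part partnC.
have pc : coprime p m`_p^' by rewrite prime_coprime // -p'natE // part_pnat.
move: (logn p m) (m`_p^')%N Em pc => a m' -> pc.
by rewrite expnD -muln_modr Euler_exp_totient // muln_modr muln1.
Qed.

(** * The subfield fixed by a power of Frobenius *)

Section FixedField.
Variables (F : finFieldType) (p k : nat).
Hypothesis pF : p \in [pchar F].

Definition frob_fixed : {pred F} := [pred a | a ^+ (p ^ k) == a].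

Lemma frob_fixed_divring_closed : divring_closed frob_fixed.
Proof.
have qn : [pchar F].-nat (p ^ k)%N.
  by rewrite (eq_pnat _ (pcharf_eq pF)) pnatX (pnat_id (pcharf_prime pF)).
split=> [|a b|a b]; rewrite !inE ?expr1n // => /eqP aK /eqP bK.
  by rewrite exprDn_pchar // exprNn_pchar // aK bK.
by rewrite exprMn exprVn aK bK.
Qed.

Definition frob_fixed_field : divringClosed F :=
  HB.pack_for (divringClosed F) frob_fixed
    (GRing.isDivringClosed.Build F frob_fixed frob_fixed_divring_closed).

Lemma frob_fixedE b : (b \in frob_fixed_field) = (b ^+ (p ^ k) == b).
Proof. by []. Qed.

Lemma card_frob_fixed : (0 < k)%N -> (#|frob_fixed_field| <= p ^ k)%N.
Proof.
move=> k_gt0; have q_gt1 : (1 < p ^ k)%N.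
  by rewrite -(expn0 p) ltn_exp2l // prime_gt1 ?(pcharf_prime pF).
have szP : size ('X^(p ^ k) - 'X : {poly F}) = (p ^ k).+1.
  by rewrite size_polyDl ?size_polyXn // size_polyN size_polyX.
rewrite cardE -ltnS -szP; apply: max_poly_roots.
- by rewrite -size_poly_eq0 szP.
- by apply/allP=> a; rewrite mem_enum frob_fixedE rootE !hornerE subr_eq0.
- exact: enum_uniq.
Qed.
End FixedField.

(** * Trace and determinant identities for 2 x 2 matrices *)

Section TwoByTwo.
Variable R : comNzRingType.
Implicit Types A B : 'M[R]_2.

Lemma mx2P A B :
  A 0 0 = B 0 0 -> A 0 1 = B 0 1 -> A 1 0 = B 1 0 -> A 1 1 = B 1 1 -> A = B.
Proof.
move=> e00 e01 e10 e11; apply/matrixP => i j.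
have I2 (k : 'I_2) : k = 0 \/ k = 1.
  by case: k => [[|[|//]] lt_k]; [left | right]; apply: val_inj.
by case: (I2 i) (I2 j) => -> [] ->.
Qed.

Lemma sum2E (f : 'I_2 -> R) : \sum_i f i = f 0 + f 1.
Proof. by rewrite !big_ord_recl big_ord0 addr0; congr (_ + f _); apply: val_inj. Qed.

Lemma mulmx2E m n (A : 'M[R]_(m, 2)) (B : 'M[R]_(2, n)) i j :
  (A *m B) i j = A i 0 * B 0 j + A i 1 * B 1 j.
Proof. by rewrite mxE sum2E. Qed.

Lemma tr2E A : \tr A = A 0 0 + A 1 1.
Proof. exact: sum2E. Qed.

Lemma det2E A : \det A = A 0 0 * A 1 1 - A 0 1 * A 1 0.
Proof.
rewrite (expand_det_row _ 0) sum2E /cofactor !det_mx11 !mxE /= expr0 expr1 mul1r mulN1r mulrN.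
by congr (_ * A _ _ - _ * A _ _); apply: val_inj.
Qed.

(** Cayley-Hamilton ([sqmx2]) polarised; it serves to reorder [B *m A] into [A *m B] with only
    traces as coefficients. *)
Lemma mulmx2_anticomm A B :
  A *m B + B *m A = \tr A *: B + \tr B *: A + (\tr (A *m B) - \tr A * \tr B)%:M.
Proof. by apply: mx2P; rewrite !(tr2E, mulmx2E, mxE) /=; ring. Qed.

Lemma sqmx2 A : A *m A = \tr A *: A - (\det A)%:M.
Proof. by apply: mx2P; rewrite !(tr2E, det2E, mulmx2E, mxE) /=; ring. Qed.

Lemma det2B A B :
  \det (A - B) = \det A - (\tr A * \tr B - \tr (A *m B)) + \det B.
Proof. by rewrite !(tr2E, det2E, mulmx2E, mxE) /=; ring. Qed.

End TwoByTwo.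

(** * Spans of [1, X, Y, XY] over a subfield *)

Section QuadSpan.
Variables (F : finFieldType) (K : divringClosed F) (n : nat) (X Y : 'M[F]_n).

Definition quad_comb (t : F * F * F * F) : 'M[F]_n :=
  t.1.1.1%:M + t.1.1.2 *: X + t.1.2 *: Y + t.2 *: (X *m Y).

(** As an image of [K^4] the span is a finite set whose size is bounded by [#|K|], whatever the size
    of [F]. *)
Definition quad_span : {set 'M[F]_n} :=
  quad_comb @: setX (setX (setX [set a in K] [set a in K]) [set a in K]) [set a in K].

Lemma quad_spanP M :
  reflect (exists a b c d, [/\ a \in K, b \in K, c \in K, d \in K &
             M = a%:M + b *: X + c *: Y + d *: (X *m Y)])
          (M \in quad_span).
Proof.
apply: (iffP imsetP) => [[[[[a b] c] d]]|[a [b [c [d [aK bK cK dK ->]]]]]].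
  rewrite !inE /= => /andP[/andP[/andP[aK bK] cK] dK] ->.
  by exists a, b, c, d.
by exists (a, b, c, d); rewrite // !inE /= aK bK cK dK.
Qed.

Lemma card_quad_span : (#|quad_span| <= #|K| ^ 4)%N.
Proof.
apply: leq_trans (leq_imset_card _ _) _.
by rewrite !cardsX !cardsE !expnS expn0 muln1 !mulnA.
Qed.

Lemma quad_span_scalar a : a \in K -> a%:M \in quad_span.
Proof.
by move=> aK; apply/quad_spanP; exists a, 0, 0, 0; rewrite !rpred0 !scale0r !addr0.
Qed.

Lemma quad_spanD M N : M \in quad_span -> N \in quad_span -> M + N \in quad_span.
Proof.
case/quad_spanP=> a [b [c [d [aK bK cK dK ->]]]].
case/quad_spanP=> a' [b' [c' [d' [aK' bK' cK' dK' ->]]]].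
apply/quad_spanP; exists (a + a'), (b + b'), (c + c'), (d + d').
split; rewrite ?rpredD // !scalerDl raddfD.
by rewrite addrACA; congr (_ + _); rewrite addrACA; congr (_ + _); rewrite addrACA.
Qed.

Lemma quad_spanZ a M : a \in K -> M \in quad_span -> a *: M \in quad_span.
Proof.
move=> aK' /quad_spanP[b [c [d [e [bK cK dK eK ->]]]]].
apply/quad_spanP; exists (a * b), (a * c), (a * d), (a * e).
by split; rewrite ?rpredM // !scalerDr !scalerA scale_scalar_mx.
Qed.

Lemma quad_spanN M : M \in quad_span -> - M \in quad_span.
Proof. by rewrite -scaleN1r; apply: quad_spanZ; rewrite rpredN1. Qed.

Lemma quad_spanB M N : M \in quad_span -> N \in quad_span -> M - N \in quad_span.
Proof. by move=> HM HN; rewrite quad_spanD // quad_spanN. Qed.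

Variables (a b a' b' c0 c1 c2 c3 : F).
Hypotheses (aK : a \in K) (bK : b \in K) (aK' : a' \in K) (bK' : b' \in K).
Hypotheses (c0K : c0 \in K) (c1K : c1 \in K) (c2K : c2 \in K) (c3K : c3 \in K).
Hypotheses (XX : X *m X = a *: X + b%:M) (YY : Y *m Y = a' *: Y + b'%:M).
Hypothesis YX : Y *m X = c0%:M + c1 *: X + c2 *: Y + c3 *: (X *m Y).

Lemma quad_span_l : X \in quad_span.
Proof.
by apply/quad_spanP; exists 0, 1, 0, 0; rewrite !rpred0 rpred1 scale1r !scale0r !addr0 raddf0 add0r.
Qed.

Lemma quad_span_r : Y \in quad_span.
Proof.
by apply/quad_spanP; exists 0, 0, 1, 0; rewrite !rpred0 rpred1 scale1r !scale0r !addr0 raddf0 add0r.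
Qed.

Lemma quad_span_mul : X *m Y \in quad_span.
Proof.
by apply/quad_spanP; exists 0, 0, 0, 1; rewrite !rpred0 rpred1 scale1r !scale0r !addr0 raddf0 add0r.
Qed.

(** The only product of degree three is [X *m Y *m X]; reordering [Y *m X] turns it into terms in
    [X], [X *m X], [X *m Y] and [X *m X *m Y], which [XX] reduces. *)
Lemma quad_spanMl M : M \in quad_span -> M *m X \in quad_span.
Proof.
have HXX : X *m X \in quad_span.
  by rewrite XX quad_spanD ?quad_spanZ ?quad_span_l ?quad_span_scalar.
have HYX : Y *m X \in quad_span.
  by rewrite YX !quad_spanD ?quad_spanZ ?quad_span_l ?quad_span_r ?quad_span_mul ?quad_span_scalar.
have HXXY : X *m X *m Y \in quad_span.
  rewrite XX mulmxDl -scalemxAl mul_scalar_mx.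
  by rewrite quad_spanD ?quad_spanZ ?quad_span_mul ?quad_span_r.
case/quad_spanP=> m0 [m1 [m2 [m3 [m0K m1K m2K m3K ->]]]].
rewrite !mulmxDl -!scalemxAl mul_scalar_mx -(mulmxA X) YX !mulmxDr -!scalemxAr mul_mx_scalar.
rewrite mulmxA.
by do ![done | apply: quad_spanD | apply: quad_spanZ | exact: quad_span_scalar
      | exact: quad_span_l | exact: quad_span_r | exact: quad_span_mul].
Qed.

Lemma quad_spanMr M : M \in quad_span -> M *m Y \in quad_span.
Proof.
case/quad_spanP=> m0 [m1 [m2 [m3 [m0K m1K m2K m3K ->]]]].
rewrite !mulmxDl -!scalemxAl mul_scalar_mx -(mulmxA X) YY !mulmxDr -!scalemxAr mul_mx_scalar.
by do ![done | apply: quad_spanD | apply: quad_spanZ | exact: quad_span_scalar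
      | exact: quad_span_l | exact: quad_span_r | exact: quad_span_mul].
Qed.

End QuadSpan.

(** * Alternating matrices *)

Section Alternating.
Variable F : fieldType.

Definition alternating n (B : 'M[F]_n) : Prop := forall v : 'rV[F]_n, v *m B *m v^T = 0.

Lemma alternating_congr m n (B : 'M[F]_n) (R : 'M[F]_(m, n)) :
  alternating B -> alternating (R *m B *m R^T).
Proof. by move=> altB v; rewrite !mulmxA -[_ *m R^T *m v^T]mulmxA -trmx_mul altB. Qed.

Lemma alternatingB n (B C : 'M[F]_n) : alternating B -> alternating C -> alternating (B - C).
Proof. by move=> altB altC v; rewrite mulmxBr mulmxBl altB altC subrr. Qed.

Lemma alternatingZ n a (B : 'M[F]_n) : alternating B -> alternating (a *: B).
Proof. by move=> altB v; rewrite -scalemxAr -scalemxAl altB scaler0. Qed.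

Lemma alternating_diag n (B : 'M[F]_n) i : alternating B -> B i i = 0.
Proof.
move/(_ (delta_mx 0 i))/matrixP/(_ 0 0).
by rewrite -rowE trmx_delta -colE !mxE.
Qed.

Lemma alternating_skew n (B : 'M[F]_n) i j : alternating B -> B i j = - B j i.
Proof.
move=> altB; move: (altB (delta_mx 0 i + delta_mx 0 j)) => /matrixP/(_ 0 0).
rewrite !mulmxDl [(_ + _)^T]raddfD /= !mulmxDr -!rowE !trmx_delta -!colE !mxE.
rewrite !(alternating_diag _ altB) add0r addr0 => /eqP.
by rewrite addr_eq0 => /eqP.
Qed.

(** Every alternating 2 x 2 matrix is a multiple of [[[0, 1], [-1, 0]]], whose square is [-1]. *)
Lemma alternating2 (B C : 'M[F]_2) : alternating B -> alternating C ->
  B *m C = (- (B 0 1 * C 0 1))%:M.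
Proof.
move=> altB altC; apply: mx2P; rewrite mulmx2E !mxE /=.
all: rewrite ?(alternating_diag _ altB) ?(alternating_diag _ altC).
all: rewrite ?[B 1 0](alternating_skew _ _ altB) ?[C 1 0](alternating_skew _ _ altC) /=; ring.
Qed.

(** A nonzero entry [B i j] gives a principal 2 x 2 minor on [i, j] equal to [(B i j)^2], which
    forces rank at least 2. *)
Lemma alternating_rank_neq1 n (B : 'M[F]_n) : alternating B -> \rank B != 1%N.
Proof.
move=> altB; apply/negP => /eqP rkB.
have [B0|] := eqVneq B 0; first by rewrite B0 mxrank0 in rkB.
case/matrix0Pn => i [j Bij].
pose f (k : 'I_2) := if k == 0 then i else j.
pose R : 'M[F]_(2, n) := \matrix_k delta_mx 0 (f k).
have RE q (D : 'M[F]_(n, q)) k l : (R *m D) k l = D (f k) l.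
  transitivity ((row k (R *m D)) 0 l); first by rewrite [RHS]mxE.
  by rewrite row_mul rowK -rowE mxE.
have REt q (D : 'M[F]_(q, n)) k l : (D *m R^T) l k = D l (f k).
  by rewrite -[D *m R^T]trmxK trmx_mul trmxK [LHS]mxE RE mxE.
have altC := alternating_congr R altB.
have uC : R *m B *m R^T \in unitmx.
  rewrite unitmxE unitfE det2E !(alternating_diag _ altC).
  rewrite [X in _ - _ * X](alternating_skew _ _ altC) mul0r sub0r mulrN opprK.
  by rewrite REt RE mulf_neq0.
move: uC; rewrite -row_full_unit /row_full => /eqP rkC.
have := leq_trans (mxrankM_maxl (R *m B) R^T) (mxrankM_maxr R B).
by rewrite rkC rkB.
Qed.
End Alternating.

(** In a full rank factorization [E = C R], the equation [C R C R = C R] can be cancelled on both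
    sides. *)
Lemma idempotent_factor (F : fieldType) (n r : nat) (E : 'M[F]_n) :
  \rank E = r -> E *m E = E ->
  exists C : 'M[F]_(n, r), exists2 R : 'M[F]_(r, n), E = C *m R & R *m C = 1%:M.
Proof.
move=> <- EE; move: (mulmx_base E) (row_base_free E) (col_base_full E).
move: (col_base E) (row_base E) => C R defE /row_freeP[R' RR'] /row_fullP[C' CC'].
exists C, R => //.
have : C' *m (C *m R *m (C *m R)) *m R' = C' *m (C *m R) *m R' by rewrite defE EE.
by rewrite !mulmxA CC' !mul1mx -!mulmxA RR' mulmx1.
Qed.

(** * The symplectic form and its transvections *)

Section Symplectic.
Variable F : fieldType.
Local Notation J := (symJ F).

Lemma symJ_tr : J^T = - J.
Proof.
apply/matrixP=> [[[|[|[|[|//]]]] ?] [[|[|[|[|//]]]] ?]]; rewrite !mxE /=.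
all: by rewrite ?oppr0 ?opprK.
Qed.

Lemma symJ_sq : J *m J = - 1%:M.
Proof.
apply/matrixP=> [[[|[|[|[|//]]]] ?] [[|[|[|[|//]]]] ?]].
all: rewrite !mxE !big_ord_recl big_ord0 !mxE /=.
all: by rewrite ?(mul0r, mulr0, mul1r, mulr1, add0r, addr0, mulrN, oppr0, mulNr).
Qed.

Lemma symJ_alternating : alternating J.
Proof.
move=> v; apply/matrixP=> i j; rewrite !ord1 !mxE !big_ord_recl big_ord0 !mxE.
by rewrite !big_ord_recl !big_ord0 !mxE /=; ring.
Qed.

Lemma symJ_swap (v w : 'rV[F]_4) : (v *m J *m w^T) 0 0 = - (w *m J *m v^T) 0 0.
Proof.
have -> : v *m J *m w^T = - (w *m J *m v^T)^T.
  by rewrite !trmx_mul trmxK symJ_tr mulNmx mulmxN opprK mulmxA.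
by rewrite [LHS]mxE [X in - X]mxE.
Qed.

(** Acting on row vectors from the right, this is [v |-> v + t <v, u> u] with [<v, u> = v J u^T]. *)
Definition transvection (t : F) (u : 'rV[F]_4) : 'M[F]_4 := 1%:M + t *: (J *m u^T *m u).

Lemma mul_transvection t (v u : 'rV[F]_4) :
  v *m transvection t u = v + (t * (v *m J *m u^T) 0 0) *: u.
Proof.
rewrite mulmxDr mulmx1 -scalemxAr !mulmxA -scalerA; congr (_ + _ *: _).
by rewrite [v *m J *m u^T]mx11_scalar mul_scalar_mx !mxE eqxx mulr1n.
Qed.

Lemma transvection_symp t u : (transvection t u)^T *m J *m transvection t u = J.
Proof.
pose A := u^T *m u; have -> : transvection t u = 1%:M + t *: (J *m A) by rewrite mulmxA.
have At : A^T = A by rewrite trmx_mul trmxK.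
have AJA : A *m J *m A = 0.
  by rewrite /A -!mulmxA [u *m _]mulmxA [u *m J *m _]mulmxA symJ_alternating mul0mx mulmx0.
have -> : (1%:M + t *: (J *m A))^T = 1%:M - t *: (A *m J).
  by rewrite raddfD /= trmx1 linearZ /= trmx_mul At symJ_tr mulmxN scalerN.
rewrite mulmxBl mul1mx -scalemxAl -mulmxA symJ_sq mulmxN mulmx1 scalerN opprK.
rewrite mulmxDr mulmx1 -scalemxAr mulmxDl mulmxA symJ_sq mulNmx mul1mx.
by rewrite -scalemxAl mulmxA AJA scaler0 addr0 scalerN addrK.
Qed.

(** The hypothesis exhibits [- J M^T J] as a left inverse of [M], hence as a right inverse. The
    transposed relation is the one suited to row vectors. *)
Lemma symp_tr (M : 'M[F]_4) : M^T *m J *m M = J -> M *m J *m M^T = J.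
Proof.
move=> MJ; have : (- (J *m M^T *m J)) *m M = 1%:M.
  by rewrite mulNmx -!mulmxA [M^T *m _]mulmxA MJ symJ_sq opprK.
move/mulmx1C => MJ1; rewrite -[RHS]mul1mx -{}MJ1 !mulmxN mulNmx -!mulmxA symJ_sq.
by rewrite !mulmxN mulmx1 opprK.
Qed.

End Symplectic.

(** * Irreducibility, and bounding the order through a stable finite set *)

Section Generation.
Variable F : finFieldType.
Local Notation J := (symJ F).

Lemma Sp4_of_mx (M : 'M[F]_4) :
  M^T *m J *m M = J -> exists2 g, g \in Sp4 F & GLval g = M.
Proof.
move=> MJ; have : (- (J *m M^T *m J)) *m M = 1%:M.
  by rewrite mulNmx -!mulmxA [M^T *m _]mulmxA MJ symJ_sq opprK.
case/mulmx1_unit=> _ uM; exists (FinRing.Unit uM) => //.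
by rewrite inE; apply/eqP.
Qed.

Lemma transvectionP t u : exists2 g, g \in Sp4 F & GLval g = transvection t u.
Proof. exact/Sp4_of_mx/transvection_symp. Qed.

Lemma symJ_nondegenerate (u : 'rV[F]_4) : u != 0 -> exists w : 'rV[F]_4, (w *m J *m u^T) 0 0 = 1.
Proof.
move=> u0; have : u *m J != 0.
  apply: contra u0 => /eqP/(congr1 (fun a => a *m J)).
  by rewrite -mulmxA symJ_sq mulmxN mulmx1 mul0mx => /eqP; rewrite oppr_eq0.
case/rV0Pn=> i ui; exists (- ((u *m J) 0 i)^-1 *: delta_mx 0 i).
rewrite -!scalemxAl mxE symJ_swap trmx_delta -colE [(col _ _) _ _]mxE.
by rewrite mulrNN mulVf.
Qed.

(** Commuting with the transvection along [u] makes [u] an eigenvector, so every nonzero row vector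
    is an eigenvector of [S]. *)
Lemma Sp4_commute_scalar (S : 'M[F]_4) :
  (forall g, g \in Sp4 F -> S *m GLval g = GLval g *m S) -> exists a, S = a%:M.
Proof.
move=> comS; have eigen (u : 'rV[F]_4) : u != 0 -> exists c, u *m S = c *: u.
  move=> u0; have [w wu] := symJ_nondegenerate u0.
  have [g gS defg] := transvectionP 1 u; have := comS g gS.
  rewrite defg mulmxDr mulmxDl mulmx1 mul1mx => /addrI; rewrite !scale1r.
  move/(congr1 (fun a => w *m a)); rewrite !mulmxA.
  rewrite [w *m J *m u^T]mx11_scalar wu mul1mx => <-.
  by rewrite [w *m _ *m J *m _]mx11_scalar mul_scalar_mx; eexists.
(* Basis vectors show that [S] is diagonal; the all-ones vector forces its diagonal entries to
   agree. *)
have [|c cS] := eigen (const_mx 1).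
  by apply/rV0Pn; exists 0; rewrite mxE oner_eq0.
have offd i j : i != j -> S i j = 0.
  move=> neq_ij; have [|d dS] := eigen (delta_mx 0 i).
    by apply/rV0Pn; exists i; rewrite mxE !eqxx oner_eq0.
  move/matrixP/(_ 0 j): dS; rewrite -rowE !mxE eqxx /= eq_sym (negPf neq_ij).
  by rewrite mulr0.
exists c; apply/matrixP=> i j; rewrite mxE; have [<-|neq_ij] := eqVneq i j; last first.
  by rewrite offd.
move/matrixP/(_ 0 i): cS; rewrite !mxE (bigD1 i) //= big1 => [|k ki].
  by rewrite mxE mul1r addr0 mulr1 mulr1n.
by rewrite offd ?mulr0.
Qed.

(** Lifts of generators of [PSp4 F] generate [Sp4 F] only up to sign; this weaker condition serves
    both halves of the theorem. *)
Definition generates_mod_sign (x y : {'GL_4[F]}) : Prop :=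
  forall g, g \in Sp4 F ->
    exists2 h, h \in <<[set x; y]>>%g & GLval g = GLval h \/ GLval g = - GLval h.

Section Pair.
Variables (x y : {'GL_4[F]}).
Hypothesis gen_xy : generates_mod_sign x y.

(** The matrices carrying [P] into itself are closed under products, hence form a subgroup of the
    finite group [GL_4]; it contains [x] and [y], and stability under negation absorbs the sign. *)
Lemma generates_stable m (P : pred 'M[F]_(m, 4)) :
  (forall l, P l -> P (- l)) ->
  (forall l, P l -> P (l *m GLval x)) -> (forall l, P l -> P (l *m GLval y)) ->
  forall g, g \in Sp4 F -> forall l, P l -> P (l *m GLval g).
Proof.
move=> PN Px Py g /gen_xy[h].
have stab_group : group_set [set h : {'GL_4[F]} | [forall l, P l ==> P (l *m GLval h)]].
  apply/group_setP; split=> [|h1 h2]; rewrite !inE.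
    by apply/forallP=> l; rewrite GL_1E mulmx1 implybb.
  move=> /forallP H1 /forallP H2; apply/forallP=> l; apply/implyP=> Pl.
  by rewrite GL_MxE mulmxA; apply: (implyP (H2 _)); apply: (implyP (H1 _)).
have /subsetP sub : (<<[set x; y]>> \subset Group stab_group)%g.
  rewrite gen_subG; apply/subsetP=> k; rewrite !inE => /orP[] /eqP->.
    by apply/forallP=> l; apply/implyP; apply: Px.
  by apply/forallP=> l; apply/implyP; apply: Py.
move/sub; rewrite inE => /forallP Hh eg l Pl; have Plh := implyP (Hh l) Pl.
by case: eg => ->; rewrite ?mulmxN ?PN.
Qed.

(** Let [v] be a nonzero vector of [W]. The transvection along [u] moves [v] by [<v, u> u], so [W]
    contains every [u] not orthogonal to [v]. An orthogonal [u] is [(u + w) - w], where neither term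
    is orthogonal to [v]. *)
Lemma generates_irreducible m (W : 'M[F]_(m, 4)) :
  W != 0 -> (W *m GLval x <= W)%MS -> (W *m GLval y <= W)%MS -> row_full W.
Proof.
move=> W0 Wx Wy.
have stab g : g \in Sp4 F -> forall l : 'rV_4, (l <= W)%MS -> (l *m GLval g <= W)%MS.
  apply: (generates_stable (P := fun l => (l <= W)%MS)) => l lW.
  - by rewrite eqmx_opp.
  - exact: submx_trans (submxMr _ lW) Wx.
  - exact: submx_trans (submxMr _ lW) Wy.
have [v vW v0] : exists2 v : 'rV_4, (v <= W)%MS & v != 0.
  by have /rowV0Pn[v vW v0] := W0; exists v.
have inW (u : 'rV_4) : (v *m J *m u^T) 0 0 != 0 -> (u <= W)%MS.
  move=> vu; have [g gS defg] := transvectionP 1 u.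
  have := stab g gS v vW; rewrite defg mul_transvection mul1r => vgW.
  rewrite -(eqmx_scale u vu).
  by rewrite -[_ *: u](addKr v); apply: addmx_sub => //; rewrite eqmx_opp.
have [w wv] := symJ_nondegenerate v0.
have vw : (v *m J *m w^T) 0 0 = -1 by rewrite symJ_swap wv.
have wW : (w <= W)%MS by rewrite inW // vw oppr_eq0 oner_eq0.
rewrite -sub1mx; apply/row_subP=> i; set u := row i _.
have [vu0|] := eqVneq ((v *m J *m u^T) 0 0) 0; last exact: inW.
rewrite -[u](addrK w) addmx_sub ?eqmx_opp // inW // raddfD /= mulmxDr.
by rewrite [X in X != 0]mxE vu0 add0r vw oppr_eq0 oner_eq0.
Qed.

(** Two elements acting equally on [L] agree on the span of the rows of [L], a nonzero stable
    subspace and hence the whole space. So [Sp4 F] embeds in the maps from [L] to [L]. *)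
Lemma card_Sp4_le m (L : {set 'M[F]_(m, 4)}) (l0 : 'M[F]_(m, 4)) :
  (forall l, l \in L -> - l \in L) ->
  (forall l, l \in L -> l *m GLval x \in L) -> (forall l, l \in L -> l *m GLval y \in L) ->
  l0 \in L -> l0 != 0 -> (#|Sp4 F| <= #|L| ^ #|L|)%N.
Proof.
move=> LN Lx Ly l0L l0n0.
(* The default value 0 off [L] places [phi g] among the functions supported on [L], of which
   [#|L| ^ #|L|] take values in [L]. *)
pose phi (g : {'GL_4[F]}) := [ffun l => if l \in L then l *m GLval g else 0].
have phi_inj : {in Sp4 F &, injective phi}.
  move=> g h gS hS /ffunP eq_gh; apply: val_inj; apply/eqP; rewrite -subr_eq0.
  pose W := (\sum_(l in L) <<l>>)%MS.
  have lW l : l \in L -> (l <= W)%MS.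
    by move=> lL; apply: (sumsmx_sup l) => //; rewrite genmxE.
  have W0 : W != 0.
    by apply: contraNneq l0n0 => W0; rewrite -submx0 -W0 lW.
  have Wstab k : (forall l, l \in L -> l *m k \in L) -> (W *m k <= W)%MS.
    move=> Lk; rewrite sumsmxMr; apply/sumsmx_subP=> l lL.
    by rewrite (eqmxMr k (genmxE l)) lW ?Lk.
  have Wfull := generates_irreducible W0 (Wstab _ Lx) (Wstab _ Ly).
  have : (W <= kermx (GLval g - GLval h))%MS.
    apply/sumsmx_subP=> l lL; rewrite genmxE; apply/sub_kermxP.
    by move: (eq_gh l); rewrite !ffunE lL mulmxBr => ->; rewrite subrr.
  move/(submx_trans (submx_full 1%:M Wfull))/sub_kermxP.
  by rewrite mul1mx => /eqP.
rewrite -(card_in_imset phi_inj) -(card_pffun_on 0 [in L] [in L]).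
apply: subset_leq_card; apply/subsetP=> _ /imsetP[g gS ->].
apply/pffun_onP; split=> [|_ /imageP[l lL ->]].
  by apply/supportP=> l lL; rewrite ffunE (negPf lL).
rewrite ffunE ifT //.
exact: (generates_stable (P := fun l => l \in L)).
Qed.

End Pair.

(** The transvections along one fixed vector are already [#|F|] distinct elements. This turns a
    bound on the group into a bound on the field. *)
Lemma card_Sp4_ge : (#|F| <= #|Sp4 F|)%N.
Proof.
pose u : 'rV[F]_4 := delta_mx 0 0.
have T_inj : injective (fun t => transvection t u).
  have [|w wu] := @symJ_nondegenerate u.
    by apply/rV0Pn; exists 0; rewrite mxE !eqxx oner_eq0.
  move=> s t /= /(congr1 (fun A => w *m A)); rewrite !mul_transvection wu !mulr1.
  by move/addrI/matrixP/(_ 0 0); rewrite !mxE !eqxx !mulr1.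
rewrite -cardsT -(card_imset _ T_inj); apply: leq_trans (leq_imset_card (@GLval 4 F) _).
apply: subset_leq_card; apply/subsetP=> _ /imsetP[t _ ->].
by have [g gS <-] := transvectionP t u; apply: imset_f.
Qed.

End Generation.

(** * Symplectic matrices with cube 1 *)

Section OrderThree.
Variable F : fieldType.
Local Notation J := (symJ F).
Implicit Types x : 'M[F]_4.

Definition norm3 x : 'M[F]_4 := 1%:M + x + x *m x.

Lemma norm3_mulr x : x *m x *m x = 1%:M -> norm3 x *m x = norm3 x.
Proof. by move=> x3; rewrite !mulmxDl mul1mx x3 addrC addrA. Qed.

Lemma norm3_mull x : x *m x *m x = 1%:M -> x *m norm3 x = norm3 x.
Proof. by move=> x3; rewrite !mulmxDr mulmx1 mulmxA x3 addrC addrA. Qed.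

Lemma norm3_sq x : x *m x *m x = 1%:M -> norm3 x *m norm3 x = 3%:R *: norm3 x.
Proof.
move=> x3; rewrite {2}/norm3 !mulmxDr mulmx1 mulmxA !norm3_mulr //.
by rewrite scaler_nat !mulrS mulr0n addr0 addrA.
Qed.

(** Since [x^2 J = J x^T], the contribution of [x^2] at [v] is [<v, v x>], which cancels the
    contribution [<v x, v>] of [x]. *)
Lemma norm3_alternating x :
  x *m J *m x^T = J -> x *m x *m x = 1%:M -> alternating (norm3 x *m J).
Proof.
move=> xJ x3 v.
have x2J : x *m x *m J = J *m x^T by rewrite -[in LHS]xJ !mulmxA x3 mul1mx.
apply/matrixP=> i j; rewrite !ord1 [RHS]mxE.
rewrite !mulmxDl mul1mx x2J !mulmxDr !mulmxDl symJ_alternating add0r !mulmxA -[_ *m x^T *m _]mulmxA.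
by rewrite -trmx_mul [LHS]mxE symJ_swap addNr.
Qed.

Lemma symJ_unit : J \in unitmx.
Proof.
have : (- J) *m J = 1%:M by rewrite mulNmx symJ_sq opprK.
by case/mulmx1_unit.
Qed.

Lemma rank_norm3 x : x *m J *m x^T = J -> x *m x *m x = 1%:M -> \rank (norm3 x) != 1%N.
Proof.
move=> xJ x3; have := alternating_rank_neq1 (norm3_alternating xJ x3).
by rewrite mxrankMfree // row_free_unit symJ_unit.
Qed.

(** When 3 is invertible, [norm3 x / 3] is the projection onto the row vectors fixed by [x], and
    this is the complementary projection. *)
Definition coproj3 x : 'M[F]_4 := 1%:M - 3%:R^-1 *: norm3 x.

Lemma coproj3_alternating x :
  x *m J *m x^T = J -> x *m x *m x = 1%:M -> alternating (coproj3 x *m J).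
Proof.
move=> xJ x3; rewrite mulmxBl mul1mx -scalemxAl.
apply: alternatingB; first exact: symJ_alternating.
exact/alternatingZ/norm3_alternating.
Qed.

Lemma rank_coproj3 x : x *m x *m x = 1%:M -> (3%:R : F) != 0 ->
  (\rank (coproj3 x) + \rank (norm3 x) = 4)%N.
Proof.
move=> x3 n3; apply/eqP; rewrite eqn_leq; apply/andP; split.
  apply: mulmx0_rank_max.
  by rewrite mulmxBl mul1mx -scalemxAl norm3_sq // scalerA mulVf // scale1r subrr.
rewrite -{1}(mxrank1 F 4) -{1}[1%:M](subrK (3%:R^-1 *: norm3 x)).
apply: leq_trans (mxrank_add _ _) _; rewrite leq_add2l.
by rewrite mxrank_scale_nz ?invr_eq0.
Qed.

(** If 3 is invertible, the ranks of [norm3 x] and [coproj3 x] add up to 4 and neither is 1, because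
    both become alternating after multiplication by [J]; so they are 0, 2 or 4. *)
Lemma order3_cases x : x *m J *m x^T = J -> x *m x *m x = 1%:M ->
  [\/ norm3 x = 0, x = 1%:M | (3%:R : F) != 0 /\ \rank (norm3 x) = 2%N].
Proof.
move=> xJ x3; have rk1 := rank_norm3 xJ x3.
have [n3|n3] := eqVneq (3%:R : F) 0; last first.
  have rk4 := rank_coproj3 x3 n3.
  have rke : \rank (coproj3 x) != 1%N.
    have := alternating_rank_neq1 (coproj3_alternating xJ x3).
    by rewrite mxrankMfree // row_free_unit symJ_unit.
  have [rk0|rk0] := eqVneq (\rank (coproj3 x)) 0%N.
    constructor 2; move/eqP: rk0; rewrite mxrank_eq0 subr_eq0 => /eqP def1.
    by rewrite -[x in LHS]mul1mx def1 -scalemxAl norm3_mulr.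
  have [rn0|rn0] := eqVneq (\rank (norm3 x)) 0%N.
    by constructor 1; apply/eqP; rewrite -mxrank_eq0 rn0.
  by constructor 3; split=> //; lia.
constructor 1; apply/eqP; rewrite -mxrank_eq0.
(* In characteristic 3, [norm3 x = (x - 1)^2] and [(x - 1)^3 = 0]. *)
pose N := x - 1%:M.
have NN : N *m N = norm3 x.
  rewrite /N mulmxBr mulmx1 mulmxBl mul1mx /norm3 opprB addrA.
  have -> : x *m x - x + 1%:M - x = 1%:M + x + x *m x - 3%:R *: x.
    by move: (x *m x) => xx; apply/matrixP=> i j; rewrite !mxE; ring.
  by rewrite n3 scale0r subr0.
have N3 : N *m N *m N = 0 by rewrite NN mulmxBr mulmx1 norm3_mulr // subrr.
(* Frobenius' inequality gives [2 rank(N^2) <= rank N < 4], and [rank(N^2)] is not 1, so it is 0. *)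
have := mxrank_Frobenius N N N; rewrite N3 NN mxrank0 addn0 => rkN.
have : (\rank N < 4)%N.
  rewrite ltn_neqAle rank_leq_row andbT; apply/eqP => rkN4.
  have uN : N \in unitmx by rewrite -row_full_unit /row_full rkN4.
  have := congr1 (fun A => A *m invmx N *m invmx N) N3.
  by rewrite !mul0mx !mulmxK // => N0; move: rkN4; rewrite N0 mxrank0.
by lia.
Qed.

(** Write [coproj3 x = C R]; [X] is the action of [x] on the row space of [R], where [norm3 x]
    vanishes, so [X^2 + X + 1 = 0]. Comparing with Cayley-Hamilton and [det X = 1] gives
    [(tr X + 1) X = 0], whence the trace. *)
Lemma coproj3_factor x : x *m J *m x^T = J -> x *m x *m x = 1%:M ->
  (3%:R : F) != 0 -> \rank (norm3 x) = 2%N ->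
  exists (C : 'M[F]_(4, 2)) (R : 'M[F]_(2, 4)) (X S : 'M[F]_2),
    [/\ R *m C = 1%:M, x = 1%:M + C *m (X - 1%:M) *m R,
        \det X = 1 /\ \tr X = -1, X *m X = - X - 1%:M &
        [/\ C = J *m R^T *m S, alternating S & alternating (C *m R *m J)]].
Proof.
move=> xJ x3 n3 rkn.
have rke : \rank (coproj3 x) = 2%N.
  by have := rank_coproj3 x3 n3; lia.
have ne : norm3 x *m coproj3 x = 0.
  by rewrite mulmxBr mulmx1 -scalemxAr norm3_sq // scalerA mulVf // scale1r subrr.
have ee : coproj3 x *m coproj3 x = coproj3 x.
  by rewrite {1}/coproj3 mulmxBl mul1mx -scalemxAl ne scaler0 subr0.
have [C [R defe RC]] := idempotent_factor rke ee.
have altE := coproj3_alternating xJ x3.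
have ex : coproj3 x *m x = x *m coproj3 x.
  rewrite mulmxBl mulmxBr mul1mx mulmx1 -scalemxAl -scalemxAr.
  by rewrite norm3_mulr ?norm3_mull.
have RE : R *m coproj3 x = R by rewrite defe mulmxA RC mul1mx.
have [X Rx] : exists X, R *m x = X *m R.
  by exists (R *m x *m C); rewrite -{1}RE -mulmxA ex defe !mulmxA.
have defx : x = 1%:M + C *m (X - 1%:M) *m R.
  rewrite mulmxBr mulmxBl mulmx1 -defe -mulmxA -Rx mulmxA -defe ex.
  rewrite mulmxBr mulmx1 -scalemxAr norm3_mull // /coproj3 opprB.
  by move: (_ *: _) => t; apply/matrixP=> i j; rewrite !mxE; ring.
have X2 : X *m X = - X - 1%:M.
  have : R *m norm3 x *m C = 0.
    rewrite -RE -[R *m _ *m _]mulmxA /coproj3 mulmxBl mul1mx -scalemxAl norm3_sq //.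
    by rewrite scalerA mulVf // scale1r subrr mulmx0 mul0mx.
  rewrite /norm3 !mulmxDr mulmx1 !mulmxDl RC Rx mulmxA Rx -[X *m R *m x]mulmxA Rx.
  rewrite -!mulmxA RC !mulmx1 => /eqP; rewrite addrC addr_eq0 opprD => /eqP ->.
  by rewrite addrC.
(* As [C R J = J (C R)^T], one has [C = C R J (- J C) = J R^T (- C^T J C)]. *)
pose S := - (C^T *m J *m C).
have altS : alternating S.
  move=> v; rewrite mulmxN mulNmx; have := alternating_congr C^T (@symJ_alternating F) v.
  by rewrite trmxK => ->; rewrite oppr0.
have defC : C = J *m R^T *m S.
  have skew : C *m R *m J = J *m (C *m R)^T.
    rewrite -defe; apply/matrixP=> i j; rewrite (alternating_skew _ _ altE).
    have -> : J *m (coproj3 x)^T = - (coproj3 x *m J)^T.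
      by rewrite trmx_mul symJ_tr mulNmx opprK.
    by rewrite [RHS]mxE [X in _ = - X]mxE.
  have : C *m R *m J *m (- J *m C) = C.
    by rewrite -mulmxA [J *m _]mulmxA mulmxN symJ_sq opprK mul1mx -mulmxA RC mulmx1.
  by rewrite skew trmx_mul => {1}<-; rewrite /S !mulNmx !mulmxN !mulmxA.
have altCRJ : alternating (C *m R *m J) by rewrite -defe.
(* [X] preserves the form [G = R J R^T], which is nonzero because [G S = 1]; for a 2 x 2 alternating
   [G], [X G X^T = (det X) G]. *)
have detX : \det X = 1.
  pose G := R *m J *m R^T.
  have altG : alternating G := alternating_congr R (@symJ_alternating F).
  have GS : G *m S = 1%:M by rewrite -!mulmxA [J *m (_ *m _)]mulmxA -defC RC.
  have G01 : G 0 1 != 0.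
    apply/eqP=> G01; have /matrixP/(_ 0 0) := GS.
    by rewrite (alternating2 altG altS) G01 mul0r oppr0 !mxE => /esym/eqP; rewrite oner_eq0.
  have XG : X *m G *m X^T = G.
    rewrite /G !mulmxA -Rx -[_ *m R^T *m X^T]mulmxA -trmx_mul -Rx trmx_mul !mulmxA.
    by rewrite -[R *m x *m J *m x^T]mulmxA -[R *m x *m _]mulmxA [x *m _]mulmxA xJ.
  apply: (mulIf G01); rewrite mul1r -[in RHS]XG mulmx2E !mulmx2E det2E ![X^T _ _]mxE.
  rewrite !(alternating_diag _ altG) [G 1 0](alternating_skew _ _ altG); ring.
exists C, R, X, S; split=> //; split=> //.
have /matrixP X2' := sqmx2 X; have /matrixP := X2.
have X01 : (\tr X + 1) *: X = 0.
  by rewrite scalerDl scale1r -[\tr X *: X](subrK (\det X)%:M) -sqmx2 X2 detX subrK addNr.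
have uX : X \in unitmx by rewrite unitmxE detX unitr1.
move=> _; apply/eqP; rewrite -subr_eq0 opprK; apply: contraTT uX => t0.
move/eqP: X01; rewrite scaler_eq0 (negPf t0) /= => /eqP->.
by rewrite unitmxE det0 unitr0.
Qed.

End OrderThree.

(** * Preliminaries on pairs of generators *)

Lemma intertwine_exp (F : fieldType) n (P M N : 'M[F]_n.+1) k :
  P *m M = N *m P -> P *m M ^+ k = N ^+ k *m P.
Proof.
move=> PM; elim: k => [|k IHk]; first by rewrite !expr0 mulmx1 mul1mx.
by rewrite !exprS mulmxA PM -mulmxA IHk mulmxA.
Qed.

Lemma inv_expr_eq1 (F : fieldType) n (M N : 'M[F]_n.+1) m :
  M ^+ m = 1 -> M *m N = 1%:M -> N ^+ m = 1.
Proof.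
move=> Mm MN; have comMN : GRing.comm M N.
  by rewrite /GRing.comm -[M * N]/(M *m N) MN -(mulmx1C MN).
by rewrite -[LHS]mul1r -Mm -exprMn_comm // -[M * N]/(M *m N) MN expr1n.
Qed.

Lemma Sp4_row (F : finFieldType) (g : {'GL_4[F]}) :
  g \in Sp4 F -> GLval g *m symJ F *m (GLval g)^T = symJ F.
Proof. by rewrite inE => /eqP; apply: symp_tr. Qed.

(** Substituting [C1] displays the product as [R1 (C2 R2 J) R1^T] times [S1], two alternating 2 x 2
    matrices. *)
Lemma cross_scalar (F : fieldType) (C1 C2 : 'M[F]_(4, 2)) (R1 R2 : 'M[F]_(2, 4)) (S1 : 'M[F]_2) :
  C1 = symJ F *m R1^T *m S1 -> alternating S1 -> alternating (C2 *m R2 *m symJ F) ->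
  exists d, (R1 *m C2) *m (R2 *m C1) = d%:M.
Proof.
move=> -> altS altE; have altG := alternating_congr R1 altE.
by have := alternating2 altG altS; rewrite !mulmxA => ->; eexists.
Qed.

Lemma rank_basis (F : fieldType) (m n r : nat) (A : 'M[F]_(m, n)) :
  \rank A = r -> exists2 u : 'M[F]_(r, n), row_free u & (u :=: A)%MS.
Proof.
move=> <-; exists (row_base A); first exact: row_base_free.
exact: eq_row_base.
Qed.

Lemma norm3_eq0 (F : fieldType) (M : 'M[F]_4) : norm3 M = 0 -> M *m M = - M - 1%:M.
Proof. by move/eqP; rewrite /norm3 addrC addr_eq0 opprD addrC => /eqP. Qed.

(** If [x = 1], the span of [v, v y, v y^2] is nonzero and stable but has dimension at most 3. *)
Lemma generates_neq1 (F : finFieldType) (x y : {'GL_4[F]}) : generates_mod_sign x y ->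
  GLval y *m GLval y *m GLval y = 1%:M -> GLval x <> 1%:M.
Proof.
move=> gen_xy y3 x1; pose v : 'rV[F]_4 := delta_mx 0 0.
pose W := col_mx v (col_mx (v *m GLval y) (v *m GLval y *m GLval y)).
have W0 : W != 0.
  apply: contraTneq (oner_neq0 F) => W0; apply/negPn/eqP.
  have : usubmx W = 0 by rewrite W0 linear0.
  by rewrite col_mxKu => /matrixP/(_ 0 0); rewrite !mxE.
have vW : (v <= W)%MS by rewrite -addsmxE addsmxSl.
have vyW : (v *m GLval y <= W)%MS.
  by rewrite -addsmxE (submx_trans _ (addsmxSr _ _)) // -addsmxE addsmxSl.
have vyyW : (v *m GLval y *m GLval y <= W)%MS.
  by rewrite -addsmxE (submx_trans _ (addsmxSr _ _)) // -addsmxE addsmxSr.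
have : row_full W.
  apply: (generates_irreducible gen_xy W0); first by rewrite x1 mulmx1.
  have vy3 : v *m GLval y *m GLval y *m GLval y = v.
    by rewrite -!mulmxA (mulmxA (GLval y)) y3 mulmx1.
  by rewrite !mul_col_mx !col_mx_sub vyW vyyW vy3 vW.
by rewrite /row_full => /eqP rkW; have := rank_leq_row W; rewrite rkW.
Qed.

(** * The bound on the order of [Sp4 F], case by case *)

Section Bounds.
Variables (F : finFieldType) (p a k m : nat).
Hypotheses (pF : p \in [pchar F]) (pak : (p ^ (a + k) = p ^ a %[mod m])%N).
Hypotheses (m3 : (3 %| m)%N) (k_gt0 : (0 < k)%N).

Local Notation K0 := (frob_fixed_field k pF).
Local Notation K := (frob_fixed_field (k + k) pF).

Lemma fixedW b : b \in K0 -> b \in K.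
Proof.
rewrite !frob_fixedE => /eqP bK; apply/eqP.
by rewrite expnD exprM bK.
Qed.

(** Frobenius to the power [k] sends [b] to [b] or [- b], so its square fixes [b]; hence the
    exponent [k + k] in [K]. *)
Lemma fixed_sqrt b : b ^+ 2 \in K0 -> b \in K.
Proof.
have qn : [pchar F].-nat (p ^ k)%N.
  by rewrite (eq_pnat _ (pcharf_eq pF)) pnatX (pnat_id (pcharf_prime pF)).
rewrite !frob_fixedE exprAC eqf_sqr expnD exprM => /orP[] /eqP bE; rewrite bE //.
  by rewrite bE.
by rewrite exprNn_pchar // bE opprK.
Qed.

Lemma char_poly_coef_fixed n (M : 'M[F]_n.+1) i : M ^+ m = 1 -> (char_poly M)`_i \in K0.
Proof. by move=> Mm; rewrite frob_fixedE (char_poly_fixed _ pF pak Mm). Qed.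

Lemma tr_fixed n (M : 'M[F]_n.+1) : M ^+ m = 1 -> \tr M \in K0.
Proof.
by move=> Mm; rewrite -rpredN -(char_poly_trace M) // char_poly_coef_fixed.
Qed.

Lemma det_fixed n (M : 'M[F]_n.+1) : M ^+ m = 1 -> \det M \in K0.
Proof.
move=> Mm; have := char_poly_coef_fixed 0 Mm.
by rewrite char_poly_det rpredMsign.
Qed.

Lemma det_sub1_fixed n (M : 'M[F]_n.+1) : M ^+ m = 1 -> \det (M - 1%:M) \in K0.
Proof.
move=> Mm; rewrite -opprB -scaleN1r detZ rpredMsign.
have -> : \det (1%:M - M) = (char_poly M).[1].
  rewrite -[RHS]/(horner_eval 1 _) -det_map_mx; congr (\det _).
  apply/matrixP=> i j; rewrite !mxE /= /horner_eval !hornerE.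
  by rewrite hornerMn hornerX.
rewrite horner_coef; apply: rpred_sum => i _.
by rewrite expr1n mulr1 char_poly_coef_fixed.
Qed.

Lemma order3_fixed n (M : 'M[F]_n.+1) : M *m M *m M = 1%:M -> M ^+ m = 1.
Proof.
move=> M3; case/dvdnP: m3 => j ->; rewrite mulnC exprM.
by rewrite !exprS expr0 mulr1 mulrA -[M * M * M]/(M *m M *m M) M3 expr1n.
Qed.

(** The powers [b ^+ (p ^ j)] are [M ^+ (p ^ j) + M' ^+ (p ^ j)], periodic in the exponent modulo
    [m]. For 4 x 4 matrices the trace would only control [4 b], which is useless in characteristic
    2. *)
Lemma scalar_sum_fixed n (M M' : 'M[F]_n.+1) b :
  M ^+ m = 1 -> M *m M' = 1%:M -> M + M' = b%:M -> b \in K0.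
Proof.
move=> Mm MM' Mb; have M'M := mulmx1C MM'.
have M'm := inv_expr_eq1 Mm MM'.
have pM : p \in [pchar 'M[F]_n.+1] := rmorph_pchar (@scalar_mx _ n.+1) pF.
have sumX j : (b ^+ (p ^ j))%:M = M ^+ (p ^ j) + M' ^+ (p ^ j).
  elim: j => [|j IHj]; first by rewrite !expr1.
  rewrite expnSr !exprM rmorphXn /= IHj -!(pFrobenius_autE pM) pFrobenius_autD_comm //.
  apply: commrX; apply/commr_sym/commrX.
  by rewrite /GRing.comm -[M * M']/(M *m M') MM' -M'M.
rewrite frob_fixedE; apply/eqP/(exp_pchar_inj (n := a) pF) => /=.
rewrite -exprM -expnD addnC.
have : (b ^+ (p ^ (a + k)))%:M = (b ^+ (p ^ a))%:M :> 'M[F]_n.+1.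
  by rewrite !sumX (expr_modn Mm pak) (expr_modn M'm pak).
by move/matrixP/(_ 0 0); rewrite !mxE.
Qed.

Variables (x y : {'GL_4[F]}).
Hypotheses (xS : x \in Sp4 F) (yS : y \in Sp4 F) (gen_xy : generates_mod_sign x y).
Local Notation X0 := (GLval x).
Local Notation Y0 := (GLval y).
Hypotheses (x3 : X0 *m X0 *m X0 = 1%:M) (y3 : Y0 *m Y0 *m Y0 = 1%:M).
Hypotheses (xym : (X0 *m Y0) ^+ m = 1) (yxm : (Y0 *m X0) ^+ m = 1).

Local Notation Q := (p ^ (k + k))%N.
(** The exponent 12 is for the largest set used: three coefficients, each in a span of at most
    [#|K| ^ 4] elements. *)
Local Notation bound := ((Q ^ 12) ^ (Q ^ 12))%N.

Lemma card_Sp4_bound n (L : {set 'M[F]_(n, 4)}) (l0 : 'M[F]_(n, 4)) :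
  (#|L| <= #|K| ^ 12)%N ->
  (forall l, l \in L -> - l \in L) ->
  (forall l, l \in L -> l *m X0 \in L) -> (forall l, l \in L -> l *m Y0 \in L) ->
  l0 \in L -> l0 != 0 -> (#|Sp4 F| <= bound)%N.
Proof.
move=> leL LN Lx Ly l0L l0n0; apply: leq_trans (card_Sp4_le gen_xy LN Lx Ly l0L l0n0) _.
have p_gt0 : (0 < p)%N := prime_gt0 (pcharf_prime pF).
have leLQ : (#|L| <= Q ^ 12)%N.
  apply: leq_trans leL _; rewrite leq_exp2r //.
  by apply: (card_frob_fixed pF); rewrite addn_gt0 k_gt0.
apply: leq_trans (leq_pexp2l _ leLQ) _; last by rewrite leq_exp2r ?expn_gt0 ?p_gt0.
by rewrite card_gt0; apply/set0Pn; exists l0.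
Qed.

Lemma card_fixed_gt0 : (0 < #|K|)%N.
Proof. by apply/card_gt0P; exists 1; rewrite rpred1. Qed.

Lemma card_Sp4_quadratic : norm3 X0 = 0 -> norm3 Y0 = 0 -> (#|Sp4 F| <= bound)%N.
Proof.
move=> nx ny; pose S := X0 + Y0 + X0 *m Y0 + Y0 *m X0.
have xx := norm3_eq0 nx; have yy := norm3_eq0 ny.
(* By [x^2 = - x - 1], both sides equal [x y x - x - y - 1]. *)
have Sx : S *m X0 = X0 *m S.
  rewrite !mulmxDl !mulmxDr !mulmxA -[Y0 *m X0 *m X0]mulmxA xx !mulmxDr !mulmxDl.
  rewrite !mulmxN !mulNmx mulmx1 mul1mx.
  move: (Y0 *m X0) (X0 *m Y0) (X0 *m Y0 *m X0) => A B C.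
  by apply/matrixP=> i j; rewrite !mxE; ring.
have Sy : S *m Y0 = Y0 *m S.
  rewrite !mulmxDl !mulmxDr !mulmxA -[X0 *m Y0 *m Y0]mulmxA yy !mulmxDr !mulmxDl.
  rewrite !mulmxN !mulNmx mulmx1 mul1mx.
  move: (Y0 *m X0) (X0 *m Y0) (Y0 *m X0 *m Y0) => A B C.
  by apply/matrixP=> i j; rewrite !mxE; ring.
have [b Sb] : exists b, S = b%:M.
  apply: Sp4_commute_scalar => g gS; apply/eqP; rewrite -{1}[GLval g]mul1mx.
  rewrite -[GLval g in X in _ == X]mul1mx.
  apply: (generates_stable (P := fun l => S *m l == l *m S) gen_xy) => // [l|l|l|]; last first.
  - by rewrite mulmx1 mul1mx.
  - by move/eqP=> Sl; rewrite mulmxA Sl -!mulmxA Sy.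
  - by move/eqP=> Sl; rewrite mulmxA Sl -!mulmxA Sx.
  - by rewrite mulmxN mulNmx eqr_opp.
have bK : b \in K.
  apply: fixedW; rewrite -[b](addrK 1) rpredB ?rpred1 //.
  (* Here [x^-1 = - (1 + x)] and [y^-1 = - (1 + y)], so [M'] is the inverse of [x y], and the sum of
     the two is [S + 1]. *)
  apply: (scalar_sum_fixed (M := X0 *m Y0) (M' := (1%:M + Y0) *m (1%:M + X0)) xym).
    have xu : X0 *m (1%:M + X0) = - 1%:M by rewrite mulmxDr mulmx1 xx addrA addrN add0r.
    have yu : Y0 *m (1%:M + Y0) = - 1%:M by rewrite mulmxDr mulmx1 yy addrA addrN add0r.
    by rewrite mulmxA -[X0 *m Y0 *m _]mulmxA yu mulmxN mulmx1 mulNmx xu opprK.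
  rewrite [(b + 1)%:M]raddfD /= -Sb /S mulmxDl !mulmxDr !mulmx1 !mul1mx.
  move: (Y0 *m X0) (X0 *m Y0) => A B.
  by apply/matrixP=> i j; rewrite !mxE; ring.
have YX : Y0 *m X0 = b%:M + (-1) *: X0 + (-1) *: Y0 + (-1) *: (X0 *m Y0).
  rewrite -Sb /S; move: (Y0 *m X0) (X0 *m Y0) => A B.
  by apply/matrixP=> i j; rewrite !mxE; ring.
have N1K : -1 \in K by rewrite rpredN1.
have XX : X0 *m X0 = (-1) *: X0 + (-1)%:M by rewrite xx raddfN /= scaleN1r.
have YY : Y0 *m Y0 = (-1) *: Y0 + (-1)%:M by rewrite yy raddfN /= scaleN1r.
apply: (card_Sp4_bound (L := quad_span K X0 Y0) (l0 := 1%:M)).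
- apply: leq_trans (card_quad_span _ _ _) _; apply: leq_pexp2l => //.
  exact: card_fixed_gt0.
- exact: quad_spanN.
- by move=> l; apply: (quad_spanMl N1K N1K bK N1K N1K N1K XX YX).
- by move=> l; apply: (quad_spanMr N1K N1K YY).
- by rewrite quad_span_scalar ?rpred1.
- exact: (oner_neq0 'M[F]_4).
Qed.

Lemma card_Sp4_quadratic_rank2 : norm3 X0 = 0 -> \rank (norm3 Y0) = 2%N -> (#|Sp4 F| <= bound)%N.
Proof.
move=> nx rkny.
have xx := norm3_eq0 nx.
have [u ufree uE] := rank_basis rkny.
have rku : \rank u = 2%N by apply/eqP.
have uy (w : 'M[F]_(4, 4)) : (w <= u)%MS -> w *m Y0 = w.
  by rewrite uE => /submxP[D ->]; rewrite -mulmxA norm3_mulr.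
have uY : u *m Y0 = u.
  have /submxP[D ->] : (u <= norm3 Y0)%MS by rewrite uE.
  by rewrite -mulmxA norm3_mulr.
have xunit : X0 \in unitmx by case: (mulmx1_unit x3).
(* The intersection is fixed by [y], and stable under [x] because [u x^2 = - u x - u];
   irreducibility excludes it, as its dimension is at most 2. *)
have cap0 : (u :&: u *m X0)%MS = 0.
  set I := (u :&: u *m X0)%MS; apply/eqP; apply/negPn/negP => I0.
  have Iu : (I <= u)%MS := capmxSl _ _.
  have Ix : (I *m X0 <= I)%MS.
    rewrite sub_capmx submxMr // andbT.
    have /submxP[D defI] : (I <= u *m X0)%MS := capmxSr _ _.
    rewrite {1}defI -!mulmxA xx !mulmxDr !mulmxN mulmx1 -defI.
    by rewrite addmx_sub // eqmx_opp // submxMl.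
  have := generates_irreducible gen_xy I0 Ix; rewrite (uy _ Iu) => /(_ (submx_refl _)).
  by rewrite /row_full => /eqP rkI; have := mxrankS Iu; rewrite rkI rku.
have full : row_full (u + u *m X0)%MS.
  have := mxrank_sum_cap u (u *m X0).
  rewrite cap0 mxrank0 addn0 mxrankMfree ?row_free_unit // rku /row_full => ->.
  by [].
have [[A Y] /= defA] := sub_addsmxP (submx_full (u *m X0 *m Y0) full).
(* From [u x y = A u + Y u x] one gets [u x y x = - Y u + (A - Y) u x], so [B = A - Y] is the block
   needed for the companion form of [y x]. *)
have [B defB] : exists B, A = B + Y by exists (A - Y); rewrite subrK.
pose P : 'M[F]_4 := col_mx u (u *m X0).
have Punit : P \in unitmx.
  by rewrite -row_full_unit; move: full; rewrite /row_full (addsmxE u (u *m X0)).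
pose Yb : 'M[F]_4 := block_mx 1%:M 0 A Y.
pose Zb : 'M[F]_4 := block_mx 0 1%:M (- Y) B.
have PY : P *m Y0 = Yb *m P.
  rewrite [LHS](mul_col_mx u (u *m X0) Y0) [RHS](@mul_block_col _ 2 2 2 2 4).
  by rewrite uY defA mul0mx addr0 mul1mx.
have PZ : P *m (Y0 *m X0) = Zb *m P.
  rewrite mulmxA PY -mulmxA [P *m X0](mul_col_mx u (u *m X0) X0).
  rewrite [LHS](@mul_block_col _ 2 2 2 2 4) [RHS](@mul_block_col _ 2 2 2 2 4).
  rewrite mul1mx !mul0mx addr0 add0r.
  suff -> : A *m (u *m X0) + Y *m (u *m X0 *m X0) = - Y *m u + B *m (u *m X0) by [].
  rewrite -!mulmxA xx !mulmxDr !mulmxN mulmx1 defB mulmxDl mulNmx.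
  move: (B *m (u *m X0)) (Y *m (u *m X0)) (Y *m u) => a1 a2 a3.
  by apply/matrixP=> i j; rewrite !mxE; ring.
have cancelP (M : 'M[F]_4) : M *m P = P -> M = 1%:M.
  by move=> MP; rewrite -(mulmxK Punit M) MP mulmxV.
have Zm : Zb ^+ m = 1.
  by apply: cancelP; rewrite -(intertwine_exp m PZ) yxm mulmx1.
have Y3 : Y *m Y *m Y = 1%:M.
  have : Yb *m Yb *m Yb = 1%:M.
    apply: cancelP; rewrite -!mulmxA -PY [Yb *m (P *m _)]mulmxA -PY -mulmxA mulmxA -PY.
    by rewrite -!mulmxA [Y0 *m (_ *m _)]mulmxA y3 mulmx1.
  have -> : Yb *m Yb = block_mx 1%:M 0 (A + Y *m A) (Y *m Y).
    by rewrite [LHS](@mulmx_block _ 2 2 2 2 2 2) !(mul1mx, mulmx1, mul0mx, mulmx0, addr0, add0r).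
  rewrite [LHS](@mulmx_block _ 2 2 2 2 2 2) [RHS](@scalar_mx_block _ 2 2).
  by move/(congr1 (@drsubmx F 2 2 2 2)); rewrite !block_mxKdr mulmx0 add0r.
have Ym := order3_fixed Y3.
have [Y' YY'] : exists Y', Y *m Y' = 1%:M by exists (Y *m Y); rewrite mulmxA.
(* The inverse of [Zb]; its trace is [tr (Y^-1 B)], which yields [tr (Y B)] through
   [Y = tr Y - det Y Y^-1]. *)
pose Zb' : 'M[F]_4 := block_mx (Y' *m B) (- Y') 1%:M 0.
have ZZ' : Zb *m Zb' = 1%:M.
  rewrite [LHS](@mulmx_block _ 2 2 2 2 2 2) [RHS](@scalar_mx_block _ 2 2).
  rewrite !(mulNmx, mulmxN, mul1mx, mulmx1, mul0mx, mulmx0, addr0, add0r) mulmxA YY'.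
  by rewrite mul1mx addNr opprK oppr0.
have Z'm : Zb' ^+ m = 1 by apply: inv_expr_eq1 Zm ZZ'.
have trY := fixedW (tr_fixed Ym); have detY := fixedW (det_fixed Ym).
have trB : \tr B \in K.
  by have := fixedW (tr_fixed Zm); rewrite [\tr Zb](@mxtrace_block _ 2 2) mxtrace0 add0r.
have trYB : \tr (Y *m B) \in K.
  have := fixedW (tr_fixed Z'm); rewrite [\tr Zb'](@mxtrace_block _ 2 2) mxtrace0 addr0 => trY'B.
  have defY : Y = (\tr Y)%:M - \det Y *: Y'.
    rewrite -[LHS]mulmx1 -YY' mulmxA sqmx2 mulmxBl -scalemxAl YY' mul_scalar_mx.
    by rewrite scalemx1.
  have -> : \tr (Y *m B) = \tr Y * \tr B - \det Y * \tr (Y' *m B).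
    rewrite {1}defY mulmxBl mul_scalar_mx -scalemxAl.
    by rewrite [LHS]raddfB /= !mxtraceZ.
  by rewrite rpredB ?rpredM.
(* Adding the first block column of [Zb - 1] to the second gives [det (Zb - 1) = det (B - (Y + 1))];
   expanding it by [det2B] isolates [det B]. *)
have detB : \det B \in K.
  have := fixedW (det_sub1_fixed Zm).
  have -> : \det (Zb - 1%:M) = \det (B - (Y + 1%:M)).
    have Zb1 : Zb - 1%:M = block_mx (- 1%:M) 1%:M (- Y) (B - 1%:M).
      rewrite [1%:M in LHS](@scalar_mx_block _ 2 2) [- _](@opp_block_mx _ 2 2 2 2).
      rewrite [LHS](@add_block_mx _ 2 2 2 2).
      by rewrite !(oppr0, addr0, add0r).
    pose U : 'M[F]_4 := block_mx (1%:M : 'M_2) 1%:M 0 (1%:M : 'M_2).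
    have ZU : (Zb - 1%:M) *m U = block_mx (- 1%:M) 0 (- Y) (B - (Y + 1%:M)).
      rewrite Zb1 [LHS](@mulmx_block _ 2 2 2 2 2 2).
      rewrite !(mulNmx, mul1mx, mulmx1, mulmx0, addr0) addNr.
      by rewrite [- Y + _]addrC opprD addrA addrAC.
    have := congr1 determinant ZU; rewrite det_mulmx.
    rewrite [\det U](@det_ublock _ 2 2) [RHS](@det_lblock _ 2 2) !det1 !mulr1 => ->.
    by rewrite -scaleN1r detZ det1 mulr1 sqrrN expr1n mul1r.
  have -> : \det B = \det (B - (Y + 1%:M)) - \det (Y + 1%:M)
                    + (\tr B * (\tr Y + 2%:R) - (\tr (Y *m B) + \tr B)).
    rewrite det2B mulmxDr mulmx1 !mxtraceD mxtrace1 (mxtrace_mulC B Y).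
    by ring.
  have -> : \det (Y + 1%:M) = \det Y + \tr Y + 1.
    by rewrite !(det2E, tr2E) !mxE /=; ring.
  by move=> dK; rewrite !(rpredD, rpredN, rpredM, rpred1, rpred_nat).
have BY : B *m Y = (\tr (Y *m B) - \tr Y * \tr B)%:M + \tr B *: Y + \tr Y *: B
                   + (-1) *: (Y *m B).
  rewrite scaleN1r -[LHS](addKr (Y *m B)) mulmx2_anticomm addrC; congr (_ - _).
  by rewrite addrC -addrA; congr (_ + _); rewrite addrC.
(* In coordinates with respect to [u] and [u x], both generators act through right multiplication by
   [Y] and [B], so coordinates in [H] remain in [H]. *)
pose H := quad_span K Y B.
pose f (h : 'M[F]_2 * 'M[F]_2) := h.1 *m u + h.2 *m (u *m X0).
have N1K : -1 \in K by rewrite rpredN1.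
have c0K : \tr (Y *m B) - \tr Y * \tr B \in K by rewrite rpredB ?rpredM.
have YY : Y *m Y = \tr Y *: Y + (- \det Y)%:M by rewrite sqmx2 raddfN.
have BB : B *m B = \tr B *: B + (- \det B)%:M by rewrite sqmx2 raddfN.
have NdetY : - \det Y \in K by rewrite rpredN.
have NdetB : - \det B \in K by rewrite rpredN.
have HY h : h \in H -> h *m Y \in H by apply: (quad_spanMl trY NdetY c0K trB trY N1K YY BY).
have HB h : h \in H -> h *m B \in H by apply: (quad_spanMr trB NdetB BB).
apply: (card_Sp4_bound (L := f @: setX H H) (l0 := u)).
- apply: leq_trans (leq_imset_card _ _) _; rewrite cardsX.
  apply: leq_trans (leq_mul (card_quad_span _ _ _) (card_quad_span _ _ _)) _.
  by rewrite -expnD leq_pexp2l ?card_fixed_gt0.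
- move=> _ /imsetP[[h1 h2] /setXP[/= H1 H2] ->].
  apply/imsetP; exists (- h1, - h2); first by rewrite inE /= !quad_spanN.
  by rewrite /f /= opprD !mulNmx.
- move=> _ /imsetP[[h1 h2] /setXP[/= H1 H2] ->].
  apply/imsetP; exists (- h2, h1 - h2).
    by rewrite inE /= quad_spanN // quad_spanB.
  rewrite /f /= mulmxDl -!mulmxA xx !mulmxDr !mulmxN mulmx1 mulmxBl mulNmx.
  move: (h1 *m _) (h2 *m _) (h2 *m _) => a1 a2 a3.
  by apply/matrixP=> i j; rewrite !mxE; ring.
- move=> _ /imsetP[[h1 h2] /setXP[/= H1 H2] ->].
  apply/imsetP; exists (h1 + h2 *m B + h2 *m Y, h2 *m Y).
    by rewrite inE /= !quad_spanD ?HB ?HY.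
  rewrite /f /= mulmxDl -mulmxA uY -[h2 *m (u *m X0) *m _]mulmxA defA mulmxDr !mulmxA addrA.
  by congr (_ + _); rewrite -addrA -mulmxDr -defB mulmxDl.
- apply/imsetP; exists (1%:M, 0).
    rewrite inE /= quad_span_scalar ?rpred1 //.
    by rewrite -[0](raddf0 (@scalar_mx F 2)) quad_span_scalar ?rpred0.
  by rewrite /f /= mul1mx mul0mx addr0.
- by rewrite -mxrank_eq0 rku.
Qed.

Lemma card_Sp4_rank2 : (3%:R : F) != 0 -> \rank (norm3 X0) = 2%N -> \rank (norm3 Y0) = 2%N ->
  (#|Sp4 F| <= bound)%N.
Proof.
move=> n3 rkx rky.
have [C1 [R1 [X [S1 [RC1 defx [detX trX] XX [defC1 altS1 altE1]]]]]] :=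
  coproj3_factor (Sp4_row xS) x3 n3 rkx.
have [C2 [R2 [Y [S2 [RC2 defy [detY trY] YY [defC2 altS2 altE2]]]]]] :=
  coproj3_factor (Sp4_row yS) y3 n3 rky.
have [d MNd] := cross_scalar defC1 altS1 altE2.
have [d' NMd'] := cross_scalar defC2 altS2 altE1.
have [M defM] : exists M, M = R1 *m C2 by exists (R1 *m C2).
have [N defN] : exists N, N = R2 *m C1 by exists (R2 *m C1).
rewrite -defM -defN in MNd NMd'.
(* Bracketing [M N M] in two ways gives [d' M = d M], which settles the case of nonzero [M]. *)
have NMd : N *m M = d%:M.
  have [M0|M0] := eqVneq M 0.
    by rewrite -MNd M0 mulmx0 mul0mx.
  rewrite NMd'; congr (_%:M); apply/eqP; rewrite -subr_eq0.
  have : (d' - d) *: M = 0.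
    by rewrite scalerBl -mul_mx_scalar -mul_scalar_mx -NMd' -MNd mulmxA subrr.
  by move/eqP; rewrite scaler_eq0 (negPf M0) orbF.
have detK : (3%:R * (1 - d)) ^+ 2 \in K0.
  have detYK : \det Y0 \in K0 by apply: det_fixed; apply: order3_fixed.
  have detY0 : \det Y0 != 0.
    by have [_] := mulmx1_unit y3; rewrite unitmxE unitfE.
  have := det_sub1_fixed xym.
  have -> : X0 *m Y0 - 1%:M = (X0 - Y0 *m Y0) *m Y0 by rewrite mulmxBl y3.
  rewrite det_mulmx => /(rpred_div)/(_ detYK); rewrite mulfK //.
  suff -> : \det (X0 - Y0 *m Y0) = (3%:R * (1 - d)) ^+ 2 by [].
  have y2 : Y0 *m Y0 = 1%:M + C2 *m (Y *m Y - 1%:M) *m R2.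
    have -> : Y *m Y - 1%:M = (Y - 1%:M) *m (Y - 1%:M) + (Y - 1%:M) + (Y - 1%:M).
      rewrite mulmxBl mul1mx mulmxBr mulmx1; move: (Y *m Y) => YY'.
      by apply/matrixP=> i j; rewrite !mxE; ring.
    rewrite defy; move: (Y - 1%:M) => c.
    have -> : C2 *m (c *m c + c + c) *m R2 =
              C2 *m c *m R2 *m (C2 *m c *m R2) + C2 *m c *m R2 + C2 *m c *m R2.
      rewrite !mulmxDr !mulmxDl; congr (_ + _ + _).
      by rewrite !mulmxA -[_ *m R2 *m C2]mulmxA RC2 mulmx1.
    rewrite mulmxDl mul1mx mulmxDr mulmx1; move: (C2 *m c *m R2) => A.
    by move: (A *m A) => AA; apply/matrixP=> i j; rewrite !mxE; ring.
  (* As [Y^2 - 1 = - (Y + 2)], [x - y^2] factors through [D]. The factor 9 is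
     [det (X - 1) det (Y + 2)], and [(1 - d)^2] is the determinant of [[[1, M], [N, 1]]]. *)
  pose D : 'M[F]_4 := block_mx (X - 1%:M) 0 0 (Y + 2%:R%:M).
  pose Rb : 'M[F]_4 := col_mx R1 R2.
  pose Cb : 'M[F]_4 := row_mx C1 C2.
  have -> : X0 - Y0 *m Y0 = Cb *m D *m Rb.
    rewrite [Cb *m D](@mul_row_block _ 4 2 2 2 2) !mulmx0 addr0 add0r.
    rewrite [RHS](@mul_row_col _ 4 2 2 4) y2 defx YY.
    have -> : Y + 2%:R%:M = - (- Y - 1%:M - 1%:M).
      by apply/matrixP=> i j; rewrite !mxE; ring.
    rewrite mulmxN mulNmx; move: (C1 *m _ *m _) (C2 *m _ *m _) => A B.
    by apply/matrixP=> i j; rewrite !mxE; ring.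
  have -> : \det (Cb *m D *m Rb) = \det D * \det (Rb *m Cb).
    by rewrite !det_mulmx; ring.
  have -> : Rb *m Cb = block_mx 1%:M M N 1%:M.
    by rewrite [LHS](@mul_col_row _ 2 2 4 2 2) RC1 RC2 -defM -defN.
  pose U : 'M[F]_4 := block_mx 1%:M 0 N 1%:M.
  pose U' : 'M[F]_4 := block_mx 1%:M M 0 ((1 - d)%:M : 'M_2).
  have -> : block_mx 1%:M M N 1%:M = U *m U' :> 'M[F]_4.
    rewrite [RHS](@mulmx_block _ 2 2 2 2 2 2) !(mul1mx, mulmx1, mul0mx, mulmx0, addr0, add0r).
    by rewrite NMd -raddfD /= [d + _]addrC subrK.
  rewrite det_mulmx [\det U](@det_lblock _ 2 2) [\det U'](@det_ublock _ 2 2).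
  rewrite [\det D](@det_lblock _ 2 2) !det1 !mul1r det_scalar exprMn; congr (_ * _).
  have -> : \det (X - 1%:M) = \det X - \tr X + 1.
    by rewrite !(det2E, tr2E) !mxE /=; ring.
  have -> : \det (Y + 2%:R%:M) = \det Y + \tr Y * 2%:R + 4%:R.
    by rewrite !(det2E, tr2E) !mxE /=; ring.
  by rewrite detX detY trX trY; ring.
have dK : d \in K.
  have := fixed_sqrt detK; rewrite mulrC => /rpred_div/(_ (rpred_nat _ 3)).
  by rewrite mulfK // => H; rewrite -[d](subKr 1) rpredB ?rpred1.
have [T defT] : exists T, T = M *m Y *m N by exists (M *m Y *m N).
have trT : \tr T = - d.
  rewrite defT mxtrace_mulC mulmxA NMd mul_scalar_mx mxtraceZ trY; ring.
have detT : \det T = d ^+ 2.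
  rewrite defT !det_mulmx detY mulr1 -det_mulmx MNd det_scalar.
  by [].
have trXT : \tr (X *m T) \in K.
  have := fixedW (tr_fixed xym).
  have -> : \tr (X0 *m Y0) = \tr (X *m T) + 4%:R * d - 2%:R.
    have MYN : M *m (Y - 1%:M) *m N = T - d%:M.
      by rewrite mulmxBr mulmx1 mulmxBl -defT MNd.
    have trD (A B : 'M[F]_4) :
        \tr ((1%:M + A) *m (1%:M + B)) = 4%:R + \tr A + \tr B + \tr (A *m B).
      by rewrite mulmxDl mul1mx mulmxDr mulmx1 !mxtraceD mxtrace1; ring.
    have trC (C : 'M[F]_(4, 2)) c (R : 'M[F]_(2, 4)) : R *m C = 1%:M -> \tr (C *m c *m R) = \tr c.
      by move=> RC; rewrite mxtrace_mulC mulmxA RC mul1mx.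
    rewrite defx defy trD !trC //.
    have -> : C1 *m (X - 1%:M) *m R1 *m (C2 *m (Y - 1%:M) *m R2) =
              C1 *m ((X - 1%:M) *m (M *m (Y - 1%:M) *m R2)) by rewrite defM !mulmxA.
    rewrite mxtrace_mulC -[Z in _ + \tr Z]mulmxA -[M *m _ *m R2 *m C1]mulmxA -defN MYN.
    rewrite mulmxBl mul1mx mulmxBr mul_mx_scalar.
    have trB (A B : 'M[F]_2) : \tr (A - B) = \tr A - \tr B by exact: raddfB.
    rewrite !trB mxtraceZ mxtrace1 mxtrace_scalar trX trY trT.
    by ring.
  move=> trK.
  rewrite -[\tr (X *m T)](addrK (4%:R * d - 2%:R)) addrA rpredB // rpredB ?rpredM ?rpred_nat //.
have TX : T *m X = (\tr (X *m T) - \tr X * \tr T)%:M + \tr T *: X + \tr X *: T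
                   + (-1) *: (X *m T).
  rewrite scaleN1r -[LHS](addKr (X *m T)) mulmx2_anticomm addrC; congr (_ - _).
  by rewrite addrC -addrA; congr (_ + _); rewrite addrC.
have N1K : -1 \in K by rewrite rpredN1.
have trXK : \tr X \in K by rewrite trX.
have trTK : \tr T \in K by rewrite trT rpredN.
have c0K : \tr (X *m T) - \tr X * \tr T \in K by rewrite rpredB ?rpredM.
have XX' : X *m X = (-1) *: X + (-1)%:M by rewrite XX raddfN /= scaleN1r.
have TT : T *m T = \tr T *: T + (- \det T)%:M by rewrite sqmx2 raddfN.
have NdetT : - \det T \in K by rewrite detT rpredN rpredX.
pose H := quad_span K X T.
have HX h : h \in H -> h *m X \in H by apply: (quad_spanMl N1K N1K c0K trTK trXK N1K XX' TX).
have HT h : h \in H -> h *m T \in H by apply: (quad_spanMr trTK NdetT TT).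
have H0 : 0 \in H by rewrite -[0](raddf0 (@scalar_mx F 2)) quad_span_scalar ?rpred0.
(* [M] may be singular, so [R2] is replaced by [M R2] and [M Y R2]. On [R1, u2, u3] the generators
   act with coefficients involving only [d], [X] and [T]; no independence is required for an upper
   bound on the set. *)
have [u2 defu2] : exists u2, u2 = M *m R2 by exists (M *m R2).
have [u3 defu3] : exists u3, u3 = M *m Y *m R2 by exists (M *m Y *m R2).
have E1 : R1 *m X0 = X *m R1.
  by rewrite defx mulmxDr mulmx1 !mulmxA RC1 mul1mx mulmxBl mul1mx addrC subrK.
have R2x : R2 *m X0 = R2 + N *m (X - 1%:M) *m R1.
  by rewrite defx mulmxDr mulmx1 !mulmxA -defN.
have E2 : u2 *m X0 = u2 + d *: (X *m R1) - d *: R1.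
  rewrite defu2 -mulmxA R2x mulmxDr !mulmxA MNd mul_scalar_mx.
  by rewrite scalerBr mulmxBl -!scalemxAl mul1mx addrA.
have E3 : u3 *m X0 = u3 + T *m X *m R1 - T *m R1.
  rewrite defu3 -mulmxA R2x mulmxDr !mulmxA -defT mulmxBr mulmxBl mulmx1.
  by rewrite addrA.
have F1 : R1 *m Y0 = R1 + u3 - u2.
  rewrite defu2 defu3 defy mulmxDr mulmx1 !mulmxA -defM mulmxBr mulmx1 mulmxBl.
  by rewrite addrA.
have R2y : R2 *m Y0 = Y *m R2.
  by rewrite defy mulmxDr mulmx1 !mulmxA RC2 mul1mx mulmxBl mul1mx addrC subrK.
have F2 : u2 *m Y0 = u3 by rewrite defu2 defu3 -mulmxA R2y mulmxA.
have F3 : u3 *m Y0 = - u3 - u2.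
  rewrite defu2 defu3 -mulmxA R2y mulmxA -[M *m Y *m Y]mulmxA YY.
  by rewrite mulmxBr mulmxBl mulmx1 mulmxN mulNmx.
pose f (h : 'M[F]_2 * 'M[F]_2 * 'M[F]_2) := h.1.1 *m R1 + h.1.2 *m u2 + h.2 *m u3.
apply: (card_Sp4_bound (L := f @: setX (setX H H) H) (l0 := R1)).
- apply: leq_trans (leq_imset_card _ _) _; rewrite !cardsX.
  have leH : (#|H| <= #|K| ^ 4)%N := card_quad_span _ _ _.
  apply: leq_trans (leq_mul (leq_mul leH leH) leH) _.
  by rewrite -!expnD.
- move=> _ /imsetP[[[h1 h2] h3] /setXP[/= /setXP[/= H1 H2] H3] ->].
  apply/imsetP; exists (- h1, - h2, - h3); first by rewrite !inE /= !quad_spanN.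
  by rewrite /f /= !opprD !mulNmx.
- move=> _ /imsetP[[[h1 h2] h3] /setXP[/= /setXP[/= H1 H2] H3] ->].
  apply/imsetP.
  exists (h1 *m X + d *: (h2 *m X) - d *: h2 + h3 *m T *m X - h3 *m T, h2, h3).
    rewrite !inE /= H2 H3 !andbT.
    by do ![done | apply: quad_spanB | apply: quad_spanD | apply: quad_spanZ
           | apply: HX | apply: HT].
  rewrite /f /= !mulmxDl !mulNmx -!mulmxA E1 E2 E3.
  rewrite !mulmxDr !mulmxN -!scalemxAl -!scalemxAr -!mulmxA.
  move: (h1 *m (X *m R1)) (h2 *m u2) (h2 *m (X *m R1)) (h2 *m R1) (h3 *m u3).
  move: (h3 *m (T *m (X *m R1))) (h3 *m (T *m R1)) => a1 a2 a3 a4 a5 a6 a7.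
  by apply/matrixP=> i j; rewrite !mxE; ring.
- move=> _ /imsetP[[[h1 h2] h3] /setXP[/= /setXP[/= H1 H2] H3] ->].
  apply/imsetP; exists (h1, - h1 - h3, h1 + h2 - h3).
    rewrite !inE /= H1 /=.
    by rewrite !quad_spanB ?quad_spanD ?quad_spanN.
  rewrite /f /= !mulmxDl !mulNmx -!mulmxA F1 F2 F3 !mulmxDr !mulmxN.
  move: (h1 *m R1) (h1 *m u2) (h1 *m u3) (h2 *m u2) (h2 *m u3) (h3 *m u2) (h3 *m u3).
  move=> a1 a2 a3 a4 a5 a6 a7.
  by apply/matrixP=> i j; rewrite !mxE; ring.
- apply/imsetP; exists (1%:M, 0, 0).
    by rewrite !inE /= H0 quad_span_scalar ?rpred1.
  by rewrite /f /= mul1mx !mul0mx !addr0.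
- apply: contraTneq (oner_neq0 'M[F]_2) => R10.
  by rewrite negbK -[1]RC1 R10 mul0mx.
Qed.

End Bounds.

(** * Uniform bound, lifting from [PSp4], and conclusion *)

Lemma generates_mod_signC (F : finFieldType) (x y : {'GL_4[F]}) :
  generates_mod_sign x y -> generates_mod_sign y x.
Proof. by rewrite /generates_mod_sign [[set y; x]]setUC. Qed.

Lemma GLvalX (F : finFieldType) (g : {'GL_4[F]}) n : GLval (g ^+ n)%g = GLval g ^+ n.
Proof.
elim: n => [|n IHn]; first by rewrite expg0 expr0 GL_1E.
by rewrite expgS GL_MxE IHn exprS.
Qed.

Lemma card_Sp4_33c_bound (p c : nat) : prime p -> (0 < c)%N ->
  exists N : nat, forall (F : finFieldType) (x y : {'GL_4[F]}),
    p \in [pchar F] -> x \in Sp4 F -> y \in Sp4 F -> generates_mod_sign x y ->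
    (x ^+ 3 = 1)%g -> (y ^+ 3 = 1)%g -> ((x * y) ^+ c.*2 = 1)%g ->
    (#|Sp4 F| <= N)%N.
Proof.
(* The factor 3 makes the [m]-th powers of [x] and [y] trivial as well, along with their
   restrictions to 2-dimensional blocks. *)
move=> p_pr c_gt0; pose m := (3 * c.*2)%N.
have m_gt0 : (0 < m)%N by rewrite muln_gt0 double_gt0.
have m3 : (3 %| m)%N by rewrite dvdn_mulr.
have [k k_gt0 [a pak]] := expn_eventually_periodic p_pr m_gt0.
(* The bound left open here depends on [p] and [k] only, both fixed before [F]. *)
eexists => F x y pF xS yS gen_xy x3 y3 xyc.
have gen_yx := generates_mod_signC gen_xy.
have cube (g : {'GL_4[F]}) : (g ^+ 3 = 1)%g -> GLval g *m GLval g *m GLval g = 1%:M.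
  by rewrite !expgS expg0 mulg1 mulgA => g3; rewrite -!GL_MxE g3 GL_1E.
have x3' := cube _ x3; have y3' := cube _ y3.
have yxc : ((y * x) ^+ c.*2 = 1)%g.
  have -> : (y * x)%g = ((x * y) ^ x)%g by rewrite conjgE !mulgA mulVg mul1g.
  by rewrite -conjXg xyc conj1g.
have powm (g h : {'GL_4[F]}) : ((g * h) ^+ c.*2 = 1)%g -> (GLval g *m GLval h) ^+ m = 1.
  by move=> ghc; rewrite -GL_MxE -GLvalX /m mulnC expgM ghc expg1n GL_1E.
have xym := powm _ _ xyc; have yxm := powm _ _ yxc.
have [nx|x1|[n3 rkx]] := order3_cases (Sp4_row xS) x3'.
- have [ny|y1|[n3 rky]] := order3_cases (Sp4_row yS) y3'.
  + exact: (card_Sp4_quadratic pF pak k_gt0 gen_xy).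
  + by case: (generates_neq1 gen_yx x3').
  + exact: (card_Sp4_quadratic_rank2 pF pak m3 k_gt0 gen_xy).
- by case: (generates_neq1 gen_xy y3').
have [ny|y1|[_ rky]] := order3_cases (Sp4_row yS) y3'.
- exact: (card_Sp4_quadratic_rank2 pF pak m3 k_gt0 gen_yx).
- by case: (generates_neq1 gen_yx x3').
exact: (card_Sp4_rank2 pF pak m3 k_gt0 xS yS gen_xy).
Qed.

(** A central element is a scalar [b], and preserving [J] forces [b^2 = 1]. *)
Lemma Sp4_center (F : finFieldType) (z : {'GL_4[F]}) :
  z \in 'Z(Sp4 F)%g -> GLval z = 1%:M \/ GLval z = - 1%:M.
Proof.
case/centerP=> zS comz.
have [g gS|b defz] := @Sp4_commute_scalar F (GLval z).
  by have := congr1 (@GLval 4 F) (comz g gS); rewrite !GL_MxE.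
have := Sp4_row zS; rewrite defz tr_scalar_mx mul_scalar_mx mul_mx_scalar scalerA => bJ.
have : b ^+ 2 == 1.
  by move/matrixP/(_ 0 (inord 3)): bJ; rewrite !mxE /= !inordK // !mulr1 -expr2 => ->.
rewrite -[X in _ == X](expr1n F 2) eqf_sqr => /orP[]/eqP->; first by left.
by right; rewrite raddfN.
Qed.

Lemma Sp4_center_sq (F : finFieldType) (z : {'GL_4[F]}) : z \in 'Z(Sp4 F)%g -> (z ^+ 2 = 1)%g.
Proof.
move=> zZ; apply: val_inj; rewrite -[val _]/(GLval (z ^+ 2)%g) expgS expg1 GL_MxE.
by case: (Sp4_center zZ) => ->; rewrite ?mulNmx ?mulmxN ?opprK mul1mx.
Qed.

(** The kernel of the projection consists of signs, which gives generation up to sign; [(x y)^c]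
    lies in this kernel, so the exponent has to be doubled. *)
Lemma lift_33c (F : finFieldType) (c : nat) : is_33c_group (PSp4 F) c ->
  exists x y : {'GL_4[F]}, [/\ x \in Sp4 F, y \in Sp4 F, generates_mod_sign x y &
    [/\ x ^+ 3 = 1, y ^+ 3 = 1 & (x * y) ^+ c.*2 = 1]]%g.
Proof.
case=> xb [yb [gen_b xb3 yb3 xybc]].
set Z := 'Z(Sp4 F)%G; have nZ : (Sp4 F \subset 'N(Z))%g := normal_norm (center_normal _).
(* Since [x ^+ 3] is central, hence of square 1, [x ^+ 4] is a lift of order 3. *)
have lift (gb : coset_of Z) : gb \in PSp4 F -> (gb ^+ 3 = 1)%g ->
    exists g, [/\ g \in Sp4 F, coset Z g = gb & (g ^+ 3 = 1)%g].
  case/morphimP=> g gN gS -> g3; have g3Z : (g ^+ 3)%g \in Z.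
    by apply: coset_idr; rewrite ?groupX // morphX.
  exists (g ^+ 4)%g; split; first exact: groupX.
    by rewrite morphX // expgSr g3 mul1g.
  by rewrite -expgM mulnC (expgM _ 3 4) (expgM _ 2 2) (Sp4_center_sq g3Z) expg1n.
have xbP : xb \in PSp4 F by rewrite -[_ \in _]/(xb \in gval (PSp4 F)) -gen_b mem_gen ?inE ?eqxx.
have ybP : yb \in PSp4 F.
  by rewrite -[_ \in _]/(yb \in gval (PSp4 F)) -gen_b mem_gen ?inE ?eqxx ?orbT.
have [x [xS defx x3]] := lift xb xbP xb3.
have [y [yS defy y3]] := lift yb ybP yb3.
have [xN yN] : x \in 'N(Z)%g /\ y \in 'N(Z)%g by split; apply: (subsetP nZ).
exists x, y; split=> //; last first.
  split=> //; have xycZ : ((x * y) ^+ c)%g \in Z.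
    apply: coset_idr; first by rewrite groupX ?groupM.
    by rewrite morphX ?groupM //= morphM //= defx defy.
  by rewrite -muln2 expgM (Sp4_center_sq xycZ).
move=> g gS; have gN := subsetP nZ _ gS.
have : coset Z g \in (<<[set x; y]>> / Z)%g.
  have : coset Z g \in gval (PSp4 F) by apply: mem_quotient.
  rewrite -gen_b; apply/subsetP; rewrite gen_subG; apply/subsetP=> h.
  rewrite !inE => /orP[] /eqP->; rewrite -?defx -?defy; apply: mem_quotient.
    by rewrite mem_gen // !inE eqxx.
  by rewrite mem_gen // !inE eqxx orbT.
case/morphimP=> h hN hxy /= gh; exists h => //.
have /rcosetP[z zZ ->] := introT (rcoset_kercosetP gN hN) gh.
by rewrite GL_MxE; case: (Sp4_center zZ) => ->; [left | right]; rewrite ?mulNmx mul1mx.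
Qed.

Theorem mainTheorem8 (p c : nat) : prime p -> (0 < c)%N ->
  (exists N : nat, forall (r : nat) (F : finFieldType),
      (0 < r)%N -> #|F| = (p ^ r)%N -> is_33c_group (Sp4 F) c -> (r <= N)%N) /\
  (exists N : nat, forall (r : nat) (F : finFieldType),
      (0 < r)%N -> #|F| = (p ^ r)%N -> is_33c_group (PSp4 F) c -> (r <= N)%N).
Proof.
move=> p_pr c_gt0; have [N leN] := card_Sp4_33c_bound p_pr c_gt0.
(* The chain is [r < p^r = #|F| <= #|Sp4 F| <= N]. *)
have bound r (F : finFieldType) : #|F| = (p ^ r)%N -> (#|Sp4 F| <= N)%N -> (r <= N)%N.
  move=> cardF leF; apply: leq_trans (ltnW (ltn_expl r (prime_gt1 p_pr))) _.
  by rewrite -cardF (leq_trans (card_Sp4_ge F)).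
split; exists N => r F _ cardF; have pF := card_finPcharP cardF p_pr.
  case=> x [y [gen_xy x3 y3 xyc]]; apply: (bound r F cardF).
  have xyS : [set x; y] \subset Sp4 F by rewrite -gen_xy subset_gen.
  apply: (leN F x y) => //.
  - by apply: (subsetP xyS); rewrite !inE eqxx.
  - by apply: (subsetP xyS); rewrite !inE eqxx orbT.
  - by move=> g gS; exists g; [rewrite gen_xy | left].
  - by rewrite -muln2 expgM xyc expg1n.
move/lift_33c=> [x [y [xS yS gen_xy [x3 y3 xyc]]]].
exact: bound cardF (leN F x y pF xS yS gen_xy x3 y3 xyc).
Qed.
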